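(* Let $C>0$ and let $c:\mathbb{R}\to\mathbb{R}$ satisfy the cost assumptions in the context. Define $$\mathrm{KL}^\star_{\mathrm{Cactus}}:=\lim_{\varepsilon\to0^+}\ \inf_{(n,N,r)\in\mathbb{N}^2\times(0,1)}\mathrm{KL}^\star_{n,N,r}(C+\varepsilon).$$ Then $\mathrm{KL}^\star=\mathrm{KL}^\star_{\mathrm{Cactus}}$, where $\mathrm{KL}^\star$ is taken with sensitivity $s=1$ and cost bound $C$.
   Context: Cost assumptions on $c:\mathbb{R}\to\mathbb{R}$: (positivity) $c(x)\ge 0$ for all $x$ and $c(0)=0$; (symmetry) $c(x)=c(-x)$ for all $x$; (monotonicity) $c(x)\le c(x')$ whenever $|x|\le|x'|$; (continuity) $c$ is continuous on $\mathbb{R}$; (tail regularity) there exist $\alpha,\beta>0$ such that $c(x)\sim\beta x^\alpha$ as $x\to\infty$. $D(P\|Q)$ is the Kullback-Leibler divergence ($+\infty$ if $P\not\ll Q$), $\mathbb{E}_P[c]=\int c\,dP$, and $(T_aP)(B)=P(B-a)$. $\mathbb{N}$ is the set of positive integers; an infimum over the empty set is $+\infty$. $\mathscr{R}$ is the set of all Markov kernels $P_{Y|X}$ on $\mathbb{R}$ (each $P_{Y|X=x}$ is a Borel probability measure on $\mathbb{R}$ and $x\mapsto P_{Y|X=x}(B)$ is Borel for every Borel $B$). With sensitivity $s=1$, $$\mathscr{P}=\Big\{P_{Y|X}\in\mathscr{R}:\ \sup_{x\in\mathbb{R}}\int_{\mathbb{R}}c(y-x)\,P_{Y|X=x}(dy)\le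 C\Big\},\qquad \mathrm{KL}^\star=\inf_{P_{Y|X}\in\mathscr{P}}\ \sup_{x,x'\in\mathbb{R}:|x-x'|\le 1}D(P_{Y|X=x}\|P_{Y|X=x'}).$$ For positive integers $n,N$ and $r\in(0,1)$: partition $\mathbb{R}$ into intervals $\mathcal{J}_{n,0}=[-\frac1{2n},\frac1{2n}]$, $\mathcal{J}_{n,i}=(\frac{i-1/2}{n},\frac{i+1/2}{n}]$ for $i>0$, $\mathcal{J}_{n,i}=[\frac{i-1/2}{n},\frac{i+1/2}{n})$ for $i<0$. For $\boldsymbol{p}=(p_0,\ldots,p_N)\in[0,1]^{N+1}$ define $$f_{n,r,\boldsymbol{p}}(x)=\begin{cases}np_{|i|},& x\in\mathcal{J}_{n,i},\ |i|<N,\\ np_Nr^{|i|-N},& x\in\mathcal{J}_{n,i},\ |i|\ge N,\end{cases}$$ $P_{n,r,\boldsymbol{p}}(B)=\int_Bf_{n,r,\boldsymbol{p}}(x)\,dx$, and $S_{r,\boldsymbol{p}}=\int_{\mathbb{R}}f_{n,r,\boldsymbol{p}}(x)\,dx=p_0+\sum_{i=1}^{N-1}2p_i+\frac{2p_N}{1-r}$. Set $\mathscr{C}_{n,N,r}=\{P_{n,r,\boldsymbol{p}}:\boldsymbol{p}\in[0,1]^{N+1},\ S_{r,\boldsymbol{p}}=1\}$ and, for $C'>0$, $$\mathrm{KL}^\star_{n,N,r}(C')=\inf_{P\in\mathscr{C}_{n,N,r},\ \mathbb{E}_P[c]\le C'}\ \sup_{|a|\le1}D(P\|T_aP).$$ 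*)

(* Defs.v *)
From HB Require Import structures.
From mathcomp Require Import all_boot all_order all_algebra.
From mathcomp Require Import all_classical all_reals all_analysis.
From mathcomp Require Import lra.

Set Implicit Arguments.
Unset Strict Implicit.
Unset Printing Implicit Defensive.

Import Order.TTheory GRing.Theory Num.Theory.
Import numFieldNormedType.Exports.

Local Open Scope classical_set_scope.
Local Open Scope ring_scope.

Record cost_function (R : realType) (c : R -> R) : Prop := CostFunction {
  cost_ge0 : forall x, 0 <= c x ;
  cost0 : c 0 = 0 ;
  cost_sym : forall x, c x = c (- x) ;
  cost_mono : forall x x', `|x| <= `|x'| -> c x <= c x' ;
  cost_continuous : continuous c ;
  cost_tail : exists alpha beta : R, [/\ 0 < alpha, 0 < beta &
    c x / (beta * x `^ alpha) @[x --> +oo] --> (1 : R)] }.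

(* Natural logarithm, with [lne 0 = -oo]. The negative part of the integrand is
   always P-integrable, so the integral never hits the case [+oo - +oo]. *)
Definition KL d (T : measurableType d) (R : realType) (P Q : probability T R)
    : \bar R :=
  if `[< P `<< Q >]
  then (\int[P]_x lne (Radon_Nikodym (charge_of_finite_measure P) Q x))%E
  else +oo%E.

(* [k x] as a probability rather than as a mere measure. *)
Definition kernel_at d d' (X : measurableType d) (Y : measurableType d')
    (R : realType) (k : R.-pker X ~> Y) (x : X) : set Y -> \bar R := k x.

HB.instance Definition _ d d' (X : measurableType d) (Y : measurableType d')
    (R : realType) (k : R.-pker X ~> Y) (x : X) :=
  Measure.on (kernel_at k x).

HB.instance Definition _ d d' (X : measurableType d) (Y : measurableType d')
    (R : realType) (k : R.-pker X ~> Y) (x : X) :=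
  Measure_isProbability.Build _ _ _ (kernel_at k x) (prob_kernel x).

Definition feasible (R : realType) (c : R -> R) (C : R) :
    set (R.-pker R ~> R) :=
  [set k : R.-pker R ~> R |
    (ereal_sup [set \int[k x]_y (c (y - x))%:E | x in [set: R]] <= C%:E)%E].

(* [s] is the sensitivity. *)
Definition KL_star (R : realType) (s : R) (c : R -> R) (C : R) : \bar R :=
  ereal_inf [set ereal_sup [set KL (kernel_at k z.1) (kernel_at k z.2)
                            | z in [set z : R * R | `|z.1 - z.2| <= s]]
            | k in feasible c C].

Definition translation (R : realType) (a : R) : R -> R := fun x => x + a.

Lemma measurable_translation (R : realType) (a : R) :
  measurable_fun [set: R] (translation a).
Proof. by rewrite /translation; apply: measurable_realfun.measurable_funD. Qed.

HB.instance Definition _ (R : realType) (a : R) :=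
  isMeasurableFun.Build _ _ _ _ (translation a) (measurable_translation a).

(* [B - a] is the preimage of [B] under [translation a]. *)
Definition translate (R : realType) (a : R) (P : probability R R) :
  probability R R := distribution P (translation a).

Definition cell (R : realType) (n : nat) (i : int) : set R :=
  if i == 0 then `[- (2 * n%:R)^-1, (2 * n%:R)^-1]%classic
  else if 0 < i then `](i%:~R - 2^-1) / n%:R, (i%:~R + 2^-1) / n%:R]%classic
  else `[(i%:~R - 2^-1) / n%:R, (i%:~R + 2^-1) / n%:R[%classic.

(* The unique index of the cell containing [x]; see [cell_partition]. *)
Definition cell_index (R : realType) (n : nat) (x : R) : int :=
  xget 0 [set i | cell n i x].

Definition cactus_density (R : realType) (n N : nat) (r : R)
    (p : 'I_N.+1 -> R) (x : R) : R :=
  let i := `|cell_index n x|%N in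
  if (i < N)%N then n%:R * p (inord i) else n%:R * p ord_max * r ^+ (i - N).

Definition cactus_measure (R : realType) (n N : nat) (r : R)
    (p : 'I_N.+1 -> R) : set R -> \bar R :=
  fun B => (\int[lebesgue_measure]_(x in B) (cactus_density n r p x)%:E)%E.

(* Closed form of the total mass of [cactus_measure n r p]. *)
Definition cactus_mass (R : realType) (N : nat) (r : R) (p : 'I_N.+1 -> R) :
    R :=
  p ord0 + \sum_(1 <= i < N) (2 * p (inord i)) + 2 * p ord_max / (1 - r).

Definition cactus_class (R : realType) (n N : nat) (r : R) :
    set (probability R R) :=
  [set P | exists p : 'I_N.+1 -> R,
    [/\ forall i, 0 <= p i <= 1, cactus_mass r p = 1 &
        forall B, measurable B -> P B = cactus_measure n r p B]].

Definition KL_star_nNr (R : realType) (c : R -> R) (n N : nat) (r C' : R) :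
    \bar R :=
  ereal_inf [set ereal_sup [set KL P (translate a P)
                            | a in [set a : R | `|a| <= 1]]
            | P in cactus_class n N r `&` [set P | ('E_P[c] <= C'%:E)%E]].

Definition KL_star_inf (R : realType) (c : R -> R) (C' : R) : \bar R :=
  ereal_inf [set KL_star_nNr c t.1.1 t.1.2 t.2 C'
            | t in [set t : nat * nat * R |
                    [/\ (0 < t.1.1)%N, (0 < t.1.2)%N & 0 < t.2 < 1]]].

(* The limit always exists; see [is_cvg_KL_cactus]. *)
Definition KL_cactus (R : realType) (c : R -> R) (C : R) : \bar R :=
  lim (KL_star_inf c (C + e) @[e --> 0^'+]).

Lemma cellP (R : realType) (n : nat) (i : int) (x : R) : (0 < n)%N ->
  cell n i x <->
  [/\ i%:~R - 2^-1 <= n%:R * x <= i%:~R + 2^-1,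
      0 < i -> i%:~R - 2^-1 < n%:R * x & i < 0 -> n%:R * x < i%:~R + 2^-1].
Proof.
move=> n0; have n0R : 0 < n%:R :> R by rewrite ltr0n.
have lel (a : R) : (a / n%:R <= x) = (a <= n%:R * x).
  by rewrite ler_pdivrMr// mulrC.
have ler (a : R) : (x <= a / n%:R) = (n%:R * x <= a).
  by rewrite ler_pdivlMr// mulrC.
have ltl (a : R) : (a / n%:R < x) = (a < n%:R * x).
  by rewrite ltr_pdivrMr// mulrC.
have ltr (a : R) : (x < a / n%:R) = (n%:R * x < a).
  by rewrite ltr_pdivlMr// mulrC.
rewrite /cell; case: (ltgtP i 0) => [i0|i0|->] /=; rewrite in_itv/=.
- rewrite ltr lel; split=> [/andP[h1 h2]|[/andP[h1 _] _ /(_ isT) h2]].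
    by split=> //; rewrite h1 ltW.
  by rewrite h1 h2.
- rewrite ler ltl; split=> [/andP[h1 h2]|[/andP[_ h2] /(_ isT) h1 _]].
    by split=> //; rewrite h2 ltW.
  by rewrite h1 h2.
- rewrite invfM -mulNr lel ler sub0r add0r.
  by split=> [|[]].
Qed.

Lemma cell_partition (R : realType) (n : nat) (x : R) : (0 < n)%N ->
  exists! i : int, cell n i x.
Proof.
move=> n0.
have lt_cell i j : i < j -> cell n i x -> cell n j x -> False.
  move=> ij /(cellP _ _ n0)[/andP[i1 i2] _ i4] /(cellP _ _ n0)[/andP[j1 j2] j3 _].
  have ijR : i%:~R + 1 <= j%:~R :> R by rewrite -intrD1 ler_int lezD1.
  have [/j3 h|j0] := ltP 0 j.
    by clear -i2 h ijR; lra.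
  have /i4 h := lt_le_trans ij j0.
  by clear -h j1 ijR; lra.
suff [i ci] : exists i, cell n i x.
  exists i; split=> // j cj; case: (ltgtP i j) => // h; exfalso.
    exact: lt_cell h ci cj.
  exact: lt_cell h cj ci.
have [x0|x0] := leP 0 (n%:R * x).
- exists (Num.ceil (n%:R * x - 2^-1)); apply/(cellP _ _ n0).
  have /andP[] := ceil_itv (n%:R * x - 2^-1); rewrite intrB => h1 h2.
  have : (0 <= Num.ceil (n%:R * x - 2^-1)) by rewrite ceil_ge0; lra.
  move: (Num.ceil _) h1 h2 => m h1 h2 m0.
  split=> [|_|/(le_lt_trans m0)]; rewrite ?ltxx//; last lra.
  by apply/andP; split; lra.
- exists (Num.floor (n%:R * x + 2^-1)); apply/(cellP _ _ n0).
  have /andP[] := floor_itv (n%:R * x + 2^-1); rewrite intrD => h1 h2.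
  have : (Num.floor (n%:R * x + 2^-1) <= 0).
    by rewrite floor_le0; lra.
  move: (Num.floor _) h1 h2 => m h1 h2 m0.
  split=> [|/lt_le_trans/(_ m0)|_]; rewrite ?ltxx//; last lra.
  by apply/andP; split; lra.
Qed.

Lemma is_cvg_KL_cactus (R : realType) (c : R -> R) (C : R) :
  cvg (KL_star_inf c (C + e) @[e --> 0^'+]).
Proof.
apply: nonincreasing_at_right_is_cvge; near=> b => e e' _ _ ee'.
apply: le_ereal_inf_tmp => _ [t Ht <-].
apply: (@le_trans _ _ (KL_star_nNr c t.1.1 t.1.2 t.2 (C + e'))).
  by apply: ereal_inf_lbound; exists t.
apply: ereal_inf_le_tmp => _ [P [PC Pe] <-]; exists P => //; split=> //.
by apply: le_trans Pe _; rewrite lee_fin lerD2l.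
Unshelve. all: by end_near. Qed.

(* Main.v *)
Require Import Defs.
From HB Require Import structures.
From mathcomp Require Import all_boot all_order all_algebra.
From mathcomp Require Import all_classical all_reals all_analysis.
From mathcomp Require Import measurable_realfun.
From mathcomp Require Import ring lra zify.

(* Everything goes through probability mass functions [q] on the grid [Z / n]
   and the discrete divergences [D_k q] of [q] from its translates by [k / n].
   A feasible kernel is averaged over the inputs [j / n] with geometric weights
   of ratio close to 1 after recentring the output, and read off on the cells
   of the grid: by the data processing inequality and the convexity of the
   divergence, [D_k q] exceeds the divergence of the kernel by an arbitrarily
   small amount, that of the weights, so no compactness is needed. The cost
   grows by at most a factor close to 1, thanks to the regularity of [c].
   Conversely, replacing the tails of [q] by geometric ones starting at the
   same value changes the cost and the [D_k q] little when the cut is far, and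
   the piecewise constant density attached to a grid law has, for a shift
   between [k / n] and [(k + 1) / n], a divergence interpolating linearly
   between [D_k q] and [D_(k + 1) q]. This gives the bound by [KL_star]. For
   the other one, the excess cost [C + e] of a cactus law is removed by
   discretizing it and mixing it with a small amount of a narrow geometric law
   whose divergences are bounded independently of the mesh. *)

Set Implicit Arguments.
Unset Strict Implicit.
Unset Printing Implicit Defensive.

Import Order.TTheory GRing.Theory Num.Theory.
Import numFieldNormedType.Exports.

Local Open Scope classical_set_scope.
Local Open Scope ring_scope.

(** * The divergence integrand *)

(** The mesh [1 / n] divides the sensitivity 1, so shifts with [|a| <= 1] match [|k| <= n] exactly
    and the interpolation between neighbouring integer shifts stays in that range. No uniform
    average over all inputs exists; weights of ratio [expR (- delta / n)] change by a factor at most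
    [expR delta] under such a shift, and this is the only loss in divergence of the averaging.
    Cactus laws are even, hence a symmetrization, free by convexity, before the tails are replaced.
    The tail ratio can be fixed at 1/2 because on a fine mesh the cost plus one grows by a factor at
    most 3/2 per cell, so the cost of a tail is bounded by a series of ratio 3/4. The obstacle in
    bounding [KL_star] by [KL_cactus] is that a law of cost [C + e] need not be admissible for [C],
    while shrinking it would turn unit shifts into longer ones. Mixing works because the added law
    costs at most [C / 2] and its divergence bound is fixed before [e] and the mesh: the weight
    needed is proportional to [e], and so is the price. *)

(* The integrand of the divergence, normalised so as to be nonnegative: all
   divergences below are integrals or sums of nonnegative terms. The value at
   [b = 0 < a] is junk, hence the hypotheses [b = 0 -> a = 0]. *)
Definition phi (R : realType) (a b : R) : R := a * (ln a - ln b) - a + b.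

Section phi.
Variable R : realType.
Implicit Types a b t : R.

Lemma phi0l b : phi 0 b = b.
Proof. by rewrite /phi mul0r subr0 add0r. Qed.

(** For positive [a] and [b] this is [a] times the inequality [1 + u <= expR u] at
    [u = t - ln (a / b)], with equality at [u = 0]. *)
Lemma phi_tangent a b t : 0 <= a -> 0 <= b -> (b = 0 -> a = 0) ->
  a * t - b * (expR t - 1) <= phi a b.
Proof.
rewrite le_eqVlt => /predU1P[<-|a0].
  move=> b0 _; rewrite phi0l mul0r sub0r.
  by have := mulr_ge0 b0 (expR_ge0 t); lra.
rewrite le_eqVlt => /predU1P[<-/(_ erefl) a00|b0 _].
  by move: a0; rewrite a00 ltxx.
have := expR_ge1Dx (t - (ln a - ln b)).
rewrite expRB (expRB (ln a)) !lnK// => h.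
have : a * (1 + (t - (ln a - ln b))) <= a * (expR t / (a / b)).
  by rewrite ler_pM2l.
have -> : a * (expR t / (a / b)) = b * expR t.
  by field; rewrite !gt_eqF.
by rewrite /phi; lra.
Qed.

Lemma phi_ge0 a b : 0 <= a -> 0 <= b -> (b = 0 -> a = 0) -> 0 <= phi a b.
Proof.
by move=> a0 b0 ab; have := phi_tangent 0 a0 b0 ab; rewrite expR0; lra.
Qed.

Lemma phiZ t a b : 0 <= t -> 0 <= a -> 0 < b ->
  phi (t * a) (t * b) = t * phi a b.
Proof.
rewrite le_eqVlt => /predU1P[<-|t0]; first by rewrite !mul0r phi0l.
rewrite le_eqVlt => /predU1P[<-|a0 b0]; first by rewrite mulr0 !phi0l.
rewrite /phi !lnM//; ring.
Qed.

(* Legendre duality; together with [phi_tangent] it says that [phi a b] is the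
   supremum over [t] of the functions [a * t - b * (expR t - 1)], which are
   linear in [(a, b)]: every convexity argument below rests on this. *)
Lemma phi_le a b (X : \bar R) : 0 <= a -> 0 <= b -> (b = 0 -> a = 0) ->
  (forall t, ((a * t - b * (expR t - 1))%:E <= X)%E) -> ((phi a b)%:E <= X)%E.
Proof.
rewrite le_eqVlt => /predU1P[<-|a0].
  rewrite le_eqVlt => /predU1P[<- _ /(_ 0)|b0 _ h].
    by rewrite phi0l !mul0r subr0.
  rewrite phi0l; apply: contraPT h => /=; rewrite -ltNge => Xb.
  case: X Xb => [r||]//=; last by move=> _ /(_ 0).
  (* For [a = 0] the supremum [b] is only approached as [t] tends to [-oo]; this [t] already yields
     the value [(b + r) / 2], which exceeds [r]. *)
  rewrite lte_fin => rb; pose t := ln ((b - r) / (2 * b)) => /(_ t).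
  rewrite lee_fin mul0r sub0r /t lnK; last by rewrite posrE divr_gt0//; lra.
  have -> : - (b * ((b - r) / (2 * b) - 1)) = (b + r) / 2.
    by field; rewrite gt_eqF.
  by lra.
rewrite le_eqVlt => /predU1P[<-/(_ erefl) a00|b0 _].
  by move: a0; rewrite a00 ltxx.
move=> /(_ (ln a - ln b)); rewrite expRB !lnK//; congr (_%:E <= _)%E.
by rewrite /phi; field; rewrite gt_eqF.
Qed.

Lemma phiD a b a' b' : 0 <= a -> 0 <= b -> 0 <= a' -> 0 <= b' ->
  (b = 0 -> a = 0) -> (b' = 0 -> a' = 0) ->
  phi (a + a') (b + b') <= phi a b + phi a' b'.
Proof.
move=> a0 b0 a'0 b'0 ab ab'; rewrite -lee_fin; apply: phi_le.
- exact: addr_ge0.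
- exact: addr_ge0.
- move=> /eqP; rewrite paddr_eq0// => /andP[/eqP/ab -> /eqP/ab' ->].
  by rewrite addr0.
- move=> t; rewrite lee_fin.
  have := phi_tangent t a0 b0 ab; have := phi_tangent t a'0 b'0 ab'; lra.
Qed.

Lemma measurable_phi d (T : measurableType d) (f g : T -> R) (D : set T) :
  measurable_fun D f -> measurable_fun D g ->
  measurable_fun D (fun x => phi (f x) (g x)).
Proof.
move=> mf mg; apply: measurable_funD => //; apply: measurable_funB => //.
apply: measurable_funM => //.
by apply: measurable_funB => //; apply: measurableT_comp.
Qed.

(** Jensen's inequality, in the form of the log-sum inequality: for each [t] the minorant of
    [phi (f x) (g x)] given by [phi_tangent] is linear in [(f x, g x)], so it integrates to the same
    expression in [(a, b)]. *)
Lemma phi_integral d (T : measurableType d) (mu : {measure set T -> \bar R})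
    (D : set T) (f g : T -> R) (a b : R) : measurable D ->
  measurable_fun D f -> measurable_fun D g ->
  (forall x, D x -> 0 <= f x) -> (forall x, D x -> 0 <= g x) ->
  (forall x, D x -> g x = 0 -> f x = 0) ->
  (\int[mu]_(x in D) (f x)%:E = a%:E)%E ->
  (\int[mu]_(x in D) (g x)%:E = b%:E)%E -> (b = 0 -> a = 0) ->
  ((phi a b)%:E <= \int[mu]_(x in D) (phi (f x) (g x))%:E)%E.
Proof.
move=> mD mf mg f0 g0 fg fa gb ab.
have intf : mu.-integrable D (EFin \o f).
  apply/integrableP; split; first exact/measurable_EFinP.
  under eq_integral.
    by move=> x /[!inE] Dx; rewrite gee0_abs ?lee_fin ?f0//; over.
  by rewrite fa ltry.
have intg : mu.-integrable D (EFin \o g).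
  apply/integrableP; split; first exact/measurable_EFinP.
  under eq_integral.
    by move=> x /[!inE] Dx; rewrite gee0_abs ?lee_fin ?g0//; over.
  by rewrite gb ltry.
have p0 x : D x -> (0 <= (phi (f x) (g x))%:E)%E.
  by move=> Dx; rewrite lee_fin phi_ge0// ?f0 ?g0//; exact: fg.
have [Xfin|] :=
  boolP (\int[mu]_(x in D) (phi (f x) (g x))%:E \is a fin_num)%E; last first.
  rewrite ge0_fin_numE ?integral_ge0// -leNgt leye_eq => /eqP ->.
  by rewrite leey.
apply: phi_le => //.
- by rewrite -lee_fin -fa integral_ge0// => x Dx; rewrite lee_fin f0.
- by rewrite -lee_fin -gb integral_ge0// => x Dx; rewrite lee_fin g0.
move=> t.
have -> : ((a * t - b * (expR t - 1))%:E =
    \int[mu]_(x in D) (t%:E * (f x)%:E - (expR t - 1)%:E * (g x)%:E))%E.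
  rewrite integralB//; [|exact: integrableZl..].
  rewrite integralZl// integralZl// fa gb -!EFinM -EFinB; congr _%:E; ring.
apply: le_integral => //.
- apply: integrableB => //; exact: integrableZl.
- apply/integrableP; split.
    by apply/measurable_EFinP; exact: measurable_phi.
  under eq_integral.
    by move=> x /[!inE] Dx; rewrite gee0_abs ?p0//; over.
  by rewrite ltey_eq Xfin.
- move=> x /[!inE] Dx; rewrite -!EFinM -EFinB lee_fin.
  have := phi_tangent t (f0 x Dx) (g0 x Dx) (fg x Dx); lra.
Qed.

End phi.

(** * Divergence and densities *)

Section density.
Context d (T : measurableType d) (R : realType) (P : probability T R).
Variable Q : {sigma_finite_measure set T -> \bar R}.
Variable h : T -> R.
Hypotheses (mh : measurable_fun [set: T] h) (h0 : forall x, 0 <= h x).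
Hypothesis hP : forall B, measurable B -> P B = (\int[Q]_(x in B) (h x)%:E)%E.

Lemma density_dominates : P `<< Q.
Proof.
apply/null_content_dominatesP => A mA QA; rewrite hP//.
by apply: null_set_integral => //; apply/measurable_funTS/measurable_EFinP.
Qed.

Lemma ge0_integral_density (u : T -> \bar R) (D : set T) : measurable D ->
  measurable_fun [set: T] u -> (forall x, 0 <= u x)%E ->
  (\int[P]_(x in D) u x = \int[Q]_(x in D) (u x * (h x)%:E))%E.
Proof.
move=> mD mu u0; have PQ := density_dominates.
have fi := Radon_Nikodym_SigmaFinite.f_integrable PQ.
rewrite -(Radon_Nikodym_SigmaFinite.change_of_variables PQ)//; last first.
  exact: measurable_funTS.
apply: ae_eq_integral => //.
- apply: measurable_funTS; apply: emeasurable_funM => //.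
  exact: measurable_int fi.
- apply: measurable_funTS; apply: emeasurable_funM => //.
  exact/measurable_EFinP.
- apply: ae_eqe_mul2l; apply: integral_ae_eq => //.
  + exact: integrableS fi.
  + exact/measurable_funTS/measurable_EFinP.
  + by move=> E _ mE; rewrite -hP// -Radon_Nikodym_SigmaFinite.f_integral.
Qed.

End density.

Section KL_density.
Context d (T : measurableType d) (R : realType) (P Q : probability T R).
Variable h : T -> R.
Hypotheses (mh : measurable_fun [set: T] h) (h0 : forall x, 0 <= h x).
Hypothesis hP : forall B, measurable B -> P B = (\int[Q]_(x in B) (h x)%:E)%E.

(** Against [Q] the divergence becomes the integral of [h * ln h]; adding [1 - h], of integral 0,
    makes the integrand nonnegative. *)
Lemma KL_density : (KL P Q = \int[Q]_x (phi (h x) 1)%:E)%E.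
Proof.
have PQ := density_dominates mh hP.
rewrite /KL; case: asboolP => // _.
set g := Radon_Nikodym _ _.
have mg : measurable_fun setT g.
  by apply: measurable_int; apply: Radon_Nikodym_integrable.
have gfin x : g x \is a fin_num by exact: Radon_Nikodym_fin_num.
have gh : ae_eq P setT g (EFin \o h).
  apply: (null_dominates_ae_eq _ PQ) => //; apply: integral_ae_eq => //.
  - exact: Radon_Nikodym_integrable.
  - exact/measurable_EFinP.
  - by move=> E _ mE; rewrite -Radon_Nikodym_integral//= hP.
have lnegE : (fun x => lne (g x)) =
    (fun x => if (fine (g x) <= 0) then -oo%E else (ln (fine (g x)))%:E).
  by apply/funext => x; rewrite -{1}(fineK (gfin x)).
have mlneg : measurable_fun setT (fun x => lne (g x)).
  rewrite lnegE; apply: measurable_fun_ifT => //.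
  - apply: measurable_fun_ler => //; exact: measurableT_comp.
  - apply/measurable_EFinP; apply: measurableT_comp => //.
    exact: measurableT_comp.
have mlnh : measurable_fun setT (fun x => (ln (h x))%:E).
  by apply/measurable_EFinP; exact: measurableT_comp.
(* [lne (g x)] is [-oo] where [h] vanishes while [ln (h x)] is real, but that set is [P]-null. *)
rewrite (ae_eq_integral (fun x => (ln (h x))%:E)) //; last first.
  have h0P : (\forall x \ae P, 0 < h x).
    exists (h @^-1` [set 0]); split.
    - by rewrite -(setTI (_ @^-1` _)); exact: mh.
    - rewrite hP; last by rewrite -(setTI (_ @^-1` _)); exact: mh.
      rewrite (eq_integral (cst 0%E)) ?integral0// => x.
      by rewrite inE/= => ->.
    - move=> x /=; apply: contra_notP => hx.
      by rewrite lt0r h0 andbT; apply/eqP.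
  move: gh h0P; apply: filterS2 => x gh hx _.
  by rewrite (gh I) /= leNgt hx.
rewrite integralE.
have mp : measurable_fun setT (fun x => (ln (h x))%:E)^\+%E.
  exact: measurable_funepos.
have mn : measurable_fun setT (fun x => (ln (h x))%:E)^\-%E.
  exact: measurable_funeneg.
rewrite !(ge0_integral_density mh hP)//.
set Phi := (X in _ = X); set Ip := (X in (X - _)%E); set In := (X in (_ - X)%E).
have mphi1 : measurable_fun setT (fun x => (phi (h x) 1)%:E).
  by apply/measurable_EFinP; exact: measurable_phi.
have phi10 x : (0 <= (phi (h x) 1)%:E)%E.
  by rewrite lee_fin phi_ge0// => /eqP; rewrite oner_eq0.
have mhn : measurable_fun setT
    (fun x => (fun x => (ln (h x))%:E)^\- x * (h x)%:E)%E.
  by apply: emeasurable_funM => //; exact/measurable_EFinP.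
have mhp : measurable_fun setT
    (fun x => (fun x => (ln (h x))%:E)^\+ x * (h x)%:E)%E.
  by apply: emeasurable_funM => //; exact/measurable_EFinP.
have hn0 x : (0 <= (fun x => (ln (h x))%:E)^\- x * (h x)%:E)%E.
  by rewrite mule_ge0// lee_fin.
have hp0 x : (0 <= (fun x => (ln (h x))%:E)^\+ x * (h x)%:E)%E.
  by rewrite mule_ge0// lee_fin.
have Q1 : (\int[Q]_x 1 = 1)%E by rewrite integral_cst//= mul1e probability_setT.
have h1 : (\int[Q]_x (h x)%:E = 1)%E by rewrite -hP// probability_setT.
(* Where [ln (h x)] is negative, [phi (h x) 1 >= 0] bounds [- (h x * ln (h x))] by [1 - h x], hence
   by 1. *)
have Infin : In \is a fin_num.
  rewrite ge0_fin_numE ?integral_ge0//.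
  apply: (@le_lt_trans _ _ (\int[Q]_x 1)%E); last by rewrite Q1 ltry.
  apply: ge0_le_integral => //= x _.
  rewrite funenegE -EFinN -EFin_max -EFinM lee_fin.
  have := phi10 x; rewrite lee_fin.
  rewrite /phi ln1 subr0 => h1'; rewrite /Num.max; case: ifPn => _.
    by rewrite mul0r.
  have := h0 x; rewrite mulNr; lra.
have he0 x : (0 <= (h x)%:E)%E by rewrite lee_fin.
have mhe : measurable_fun setT (EFin \o h) by exact/measurable_EFinP.
(* Every term stands on the side where it is nonnegative, so the pointwise identity can be
   integrated without subtracting infinities. *)
have : (Phi + (1 + In) = Ip + 1)%E.
  have -> : (1 + In = \int[Q]_x ((h x)%:E +
      (fun x => (ln (h x))%:E)^\- x * (h x)%:E))%E.
    by rewrite ge0_integralD// h1.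
  have -> : (Ip + 1 = \int[Q]_x ((fun x => (ln (h x))%:E)^\+ x * (h x)%:E +
      1))%E.
    by rewrite ge0_integralD// Q1.
  rewrite -ge0_integralD//; last 2 first.
  - by move=> x _; rewrite adde_ge0.
  - exact: emeasurable_funD.
  apply: eq_integral => x _; rewrite funenegE funeposE -EFinN -!EFin_max -!EFinM.
  rewrite -!EFinD; congr _%:E; rewrite /phi ln1 subr0.
  have [l0|l0] := leP 0 (ln (h x)).
    by rewrite [Num.max (- _) _]max_r ?oppr_le0//; ring.
  by rewrite [Num.max (- _) _]max_l ?oppr_ge0 ?ltW//; ring.
rewrite -(fineK Infin); clear; case: Phi => [r||]; case: Ip => [s||]//=.
by rewrite -!EFinD => -[]; move: (fine In) => i e; congr _%:E; lra.
Qed.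

End KL_density.

Lemma dominates_density d (T : measurableType d) (R : realType)
    (P Q : probability T R) : P `<< Q ->
  exists h : T -> R, [/\ measurable_fun setT h, forall x, 0 <= h x &
    forall B, measurable B -> P B = (\int[Q]_(x in B) (h x)%:E)%E].
Proof.
move=> PQ; exists (fine \o Radon_Nikodym_SigmaFinite.f P Q).
have fE := Radon_Nikodym_SigmaFinite.f_integral PQ.
split.
- apply: measurableT_comp => //; apply: measurable_int.
  exact: Radon_Nikodym_SigmaFinite.f_integrable.
- by move=> x; rewrite fine_ge0// Radon_Nikodym_SigmaFinite.f_ge0.
- move=> B mB; rewrite fE//; apply: eq_integral => x _ /=.
  by rewrite fineK// Radon_Nikodym_SigmaFinite.f_fin_num.
Qed.

Lemma KL_ge0 d (T : measurableType d) (R : realType) (P Q : probability T R) :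
  (0 <= KL P Q)%E.
Proof.
have [PQ|PQ] := pselect (P `<< Q); last by rewrite /KL asboolF// leey.
have [h [mh h0 hP]] := dominates_density PQ.
rewrite (KL_density mh h0 hP) integral_ge0// => x _.
by rewrite lee_fin phi_ge0// => /eqP; rewrite oner_eq0.
Qed.

(** * Sums over the integers *)

Section esum_int.
Variable R : realType.
Implicit Types f g : int -> R.

Lemma nat_bij_int : exists e : nat -> int, set_bij [set: nat] [set: int] e.
Proof.
exists (fun k => if odd k then Negz k./2 else Posz k./2).
rewrite setTT_bijective.
exists (fun i => match i with Posz m => m.*2 | Negz m => m.*2.+1 end).
- by move=> k; have := odd_double_half k; case: ifP => /= _; rewrite ?add0n.
- by case=> m; rewrite /= ?odd_double/= ?doubleK ?uphalf_double.
Qed.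

(** One enumeration [e] serves every [u], so relations between several sums over the integers pass
    to series together. *)
Lemma esum_int_series : exists e : nat -> int,
  set_bij [set: nat] [set: int] e /\
  forall u : int -> \bar R, (forall i, 0 <= u i)%E ->
    (\esum_(i in [set: int]) u i = \sum_(k <oo) u (e k))%E.
Proof.
have [e he] := nat_bij_int; exists e; split => // u u0.
by rewrite (reindex_esum [set: nat] _ e)// nneseries_esumT.
Qed.

Lemma integral_partition_int d (T : measurableType d)
    (mu : {measure set T -> \bar R}) (E : int -> set T) (f : T -> \bar R) :
  (forall i, measurable (E i)) -> trivIset [set: int] E ->
  \bigcup_i E i = [set: T] ->
  measurable_fun [set: T] f -> (forall x, 0 <= f x)%E ->
  (\int[mu]_x f x = \esum_(i in [set: int]) \int[mu]_(x in E i) f x)%E.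
Proof.
move=> mE tE cE mf f0; have [e [he ->]] := esum_int_series; last first.
  by move=> i; apply: integral_ge0.
have UE : \bigcup_k E (e k) = setT.
  rewrite -cE; apply/seteqP; split => x [i _ Ex].
    by exists (e i).
  by have [k _ ek] := set_bij_surj he (I : setT i); exists k => //=; rewrite ek.
rewrite -UE ge0_integral_bigcup//.
- by rewrite UE.
- move=> i j _ _ Eij; apply: (set_bij_inj he); rewrite ?inE//.
  exact: tE Eij.
Qed.

Lemma phi_esum f g a b : (forall i, 0 <= f i) -> (forall i, 0 <= g i) ->
  (forall i, g i = 0 -> f i = 0) ->
  (\esum_(i in [set: int]) (f i)%:E = a%:E)%E ->
  (\esum_(i in [set: int]) (g i)%:E = b%:E)%E -> (b = 0 -> a = 0) ->
  ((phi a b)%:E <= \esum_(i in [set: int]) (phi (f i) (g i))%:E)%E.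
Proof.
move=> f0 g0 fg fa gb ab; have [e [he E]] := esum_int_series.
have p0 i : (0 <= (phi (f i) (g i))%:E)%E by rewrite lee_fin phi_ge0//; exact: fg.
have f0e i : (0 <= (f i)%:E)%E by rewrite lee_fin.
have g0e i : (0 <= (g i)%:E)%E by rewrite lee_fin.
move: fa gb; rewrite !E// -!ge0_integral_count//.
by move=> fa gb; apply: phi_integral => //= k _; exact: fg.
Qed.

End esum_int.

Section translate.
Variable R : realType.
Implicit Types (P Q : probability R R) (x a : R).

Lemma translation_preimageK a (A : set R) :
  translation a @^-1` (translation (- a) @^-1` A) = A.
Proof. by apply/seteqP; split => x /=; rewrite /translation addrK. Qed.

Lemma measurable_translation_preimage a (A : set R) :
  measurable A -> measurable (translation a @^-1` A).
Proof.
by move=> mA; rewrite -(setTI (_ @^-1` _)); exact: measurable_translation.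
Qed.

(** A translation is invertible, so it carries null sets and densities back and forth. [P'] and [Q']
    are given by their values on sets only, which lets the lemma apply to [kernel_at] as well as to
    [translate]. *)
Lemma KL_translate a P Q P' Q' :
  (forall B, measurable B -> P' B = P (translation a @^-1` B)) ->
  (forall B, measurable B -> Q' B = Q (translation a @^-1` B)) ->
  KL P' Q' = KL P Q.
Proof.
move=> hP' hQ'; have [PQ|nPQ] := pselect (P `<< Q); last first.
  rewrite /KL [in RHS]asboolF// asboolF// => /null_content_dominatesP PQ'.
  apply: nPQ; apply/null_content_dominatesP => A mA QA.
  have mB := measurable_translation_preimage (- a) mA.
  rewrite -(translation_preimageK a A) -hP'//; apply: PQ' => //.
  by have := hQ' _ mB; rewrite translation_preimageK QA.
have [h [mh h0 hP]] := dominates_density PQ.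
have mh' : measurable_fun setT (h \o translation (- a)).
  by apply: measurableT_comp => //; exact: measurable_translation.
have Q'E (f : R -> \bar R) B : measurable B -> measurable_fun setT f ->
    (forall x, 0 <= f x)%E ->
    (\int[Q']_(x in B) f x =
     \int[Q]_(x in translation a @^-1` B) f (translation a x))%E.
  move=> mB mf f0.
  rewrite -(ge0_integral_pushforward (measurable_translation a))//; last first.
    exact: measurable_funTS.
  apply: eq_measure_integral => A mA _; exact: hQ'.
have hK y : h (translation (- a) (translation a y)) = h y.
  by rewrite /translation addrK.
have h'0 x : 0 <= (h \o translation (- a)) x by exact: h0.
rewrite (KL_density mh h0 hP) (KL_density mh' h'0); last first.
  move=> B mB; rewrite hP'// hP//; last exact: measurable_translation_preimage.
  rewrite Q'E//; last exact/measurable_EFinP.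
  by apply: eq_integral => x _ /=; rewrite hK.
have := Q'E (fun x => (phi ((h \o translation (- a)) x) 1)%:E) setT.
rewrite preimage_setT => ->//.
- by apply: eq_integral => x _ /=; rewrite hK.
- by apply/measurable_EFinP; exact: measurable_phi.
- by move=> x; rewrite lee_fin phi_ge0// => /eqP; rewrite oner_eq0.
Qed.

End translate.

(** On each cell, [P (E i)] and [Q (E i)] are the [Q]-integrals of the density and of 1, so Jensen's
    inequality applies cell by cell. *)
Lemma data_processing d (T : measurableType d) (R : realType)
    (P Q : probability T R) (E : int -> set T) :
  (forall i, measurable (E i)) -> trivIset [set: int] E ->
  \bigcup_i E i = [set: T] -> P `<< Q ->
  (\esum_(i in [set: int]) (phi (fine (P (E i))) (fine (Q (E i))))%:E
   <= KL P Q)%E.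
Proof.
move=> mE tE cE PQ; have [h [mh h0 hP]] := dominates_density PQ.
have np x : (0 <= (phi (h x) 1)%:E)%E.
  by rewrite lee_fin phi_ge0// => /eqP; rewrite oner_eq0.
have mp : measurable_fun setT (fun x => (phi (h x) 1)%:E).
  by apply/measurable_EFinP; exact: measurable_phi.
rewrite (KL_density mh h0 hP) (integral_partition_int _ mE)//.
apply: le_esum => i _.
have Pfin : P (E i) \is a fin_num by rewrite fin_num_measure.
have Qfin : Q (E i) \is a fin_num by rewrite fin_num_measure.
apply: phi_integral => //.
- exact: measurable_funTS.
- by move=> x _ /eqP; rewrite oner_eq0.
- by rewrite fineK// hP.
- by rewrite fineK// integral_cst// mul1e.
- move=> QE0; have /null_content_dominatesP PQ' := PQ.
  have Q0 : Q (E i) = 0%E by rewrite -(fineK Qfin) QE0.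
  by rewrite (PQ' _ (mE i) Q0).
Qed.

(** * Grid laws *)

Local Notation "'\isum_' i F" := (\esum_(i in [set: int]) F%E)
  (at level 36, i at level 8, F at level 36).

Section esum_int_theory.
Variable R : realType.
Implicit Types (u v : int -> \bar R) (s t : R).
Lemma isumZ t u : 0 <= t -> (forall i, 0 <= u i)%E ->
  (\isum_i (t%:E * u i) = t%:E * \isum_i (u i))%E.
Proof.
move=> t0 u0; have [e [_ E]] := @esum_int_series R.
rewrite !E//; last by move=> i; rewrite mule_ge0.
by rewrite nneseriesZl.
Qed.

Lemma isum_bij u (f : int -> int) : bijective f ->
  (\isum_i (u (f i)) = \isum_i (u i))%E.
Proof.
by move=> bf; rewrite -(reindex_esum setT setT f)// setTT_bijective.
Qed.

Lemma isum_shift u (k : int) : (\isum_i (u (i + k)%R) = \isum_i (u i))%E.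
Proof.
by apply: (isum_bij u (f := fun i => i + k)); exists (fun i => i - k) => i; ring.
Qed.

Lemma isum_opp u : (\isum_i (u (- i)%R) = \isum_i (u i))%E.
Proof. by apply: (isum_bij u (f := -%R)); exists -%R; exact: opprK. Qed.

Lemma isum_exchange (a : int -> int -> \bar R) : (forall i j, 0 <= a i j)%E ->
  (\isum_i (\isum_j (a i j)) = \isum_j (\isum_i (a i j)))%E.
Proof.
move=> a0; have [e [_ E]] := @esum_int_series R.
rewrite !E; first last.
- by move=> i; apply: esum_ge0.
- by move=> i; apply: esum_ge0.
under eq_eseriesr do rewrite E//.
rewrite nneseries_interchange//.
by apply: eq_eseriesr => k _; rewrite E.
Qed.

Lemma isum_split u : (forall i, 0 <= u i)%E ->
  (\isum_i (u i) = \sum_(k <oo) u (Posz k) + \sum_(k <oo) u (Negz k))%E.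
Proof.
move=> u0; rewrite (esumID (range Posz))// !setTI; congr (_ + _)%E.
- rewrite (reindex_esum [set: nat] _ Posz) ?nneseries_esumT//.
  by split => [|x y _ _ []|] //; exact: surj_image_eq.
- rewrite (reindex_esum [set: nat] _ Negz) ?nneseries_esumT//.
  split => [k _ [] //|x y _ _ []//|[m|m] /= h].
    by exfalso; apply: h; exists m.
  by exists m.
Qed.

Lemma nneseries_geometric s : 0 <= s < 1 ->
  (\sum_(k <oo) (s ^+ k)%:E = ((1 - s)^-1)%:E)%E.
Proof.
move=> /andP[s0 s1]; apply/cvg_lim => //.
have -> : (fun n => (\sum_(0 <= k < n) (s ^+ k)%:E)%E) =
    EFin \o series (geometric 1 s).
  apply/funext => n /=; rewrite /series/= sumEFin; congr _%:E.
  by apply: eq_bigr => i _; rewrite mul1r.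
rewrite -[(1 - s)^-1]mul1r; apply: cvg_EFin; first exact: nearW.
by apply: cvg_geometric_series; rewrite ger0_norm.
Qed.

Lemma isum_geometric s : 0 <= s < 1 ->
  (\isum_i ((s ^+ `|i|)%:E) = ((1 + s) / (1 - s))%:E)%E.
Proof.
move=> /[dup] /andP[s0 s1] s01; rewrite isum_split; last first.
  by move=> i; rewrite lee_fin exprn_ge0.
rewrite nneseries_geometric//=.
under [X in (_ + X)%E]eq_eseriesr do rewrite exprS EFinM.
rewrite nneseriesZl; last by move=> i _; rewrite lee_fin exprn_ge0.
rewrite nneseries_geometric// -EFinM -EFinD; congr _%:E.
by rewrite mulrDl mul1r.
Qed.

End esum_int_theory.

(** The [D_k q] of the overview: for a law [q] the linear terms of [phi] cancel in the sum. *)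
Definition grid_div (R : realType) (q : int -> R) (k : int) : \bar R :=
  \isum_i ((phi (q i) (q (i - k)))%:E).

(** Strict positivity keeps [phi] away from its junk value for all pairs of translates. The bounds
    [B] and [K] are parameters, so each construction records exactly what it loses. *)
Record grid_mechanism (R : realType) (n : nat) (cb : int -> R) (B K : R)
    (q : int -> R) : Prop := GridMechanism {
  grid_gt0 : forall i, 0 < q i ;
  grid_sum1 : (\isum_i ((q i)%:E) = 1)%E ;
  grid_cost : (\isum_i ((q i * cb i)%:E) <= B%:E)%E ;
  grid_divergence : forall k : int, (`|k| <= n)%N -> (grid_div q k <= K%:E)%E }.

Section geometric_law.
Variables (R : realType) (rho : R).
Hypothesis rho01 : 0 < rho < 1.

Definition geometric_law (i : int) : R :=
  (1 - rho) / (1 + rho) * rho ^+ `|i|.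

Lemma geometric_law_gt0 i : 0 < geometric_law i.
Proof.
have /andP[r0 r1] := rho01.
by rewrite mulr_gt0 ?exprn_gt0// divr_gt0//; lra.
Qed.

Lemma isum_geometric_law : (\isum_j ((geometric_law j)%:E) = 1)%E.
Proof.
have /andP[r0 r1] := rho01.
under eq_esum do rewrite EFinM.
rewrite isumZ; last 2 first.
- by rewrite divr_ge0; lra.
- by move=> i; rewrite lee_fin exprn_ge0// ltW.
rewrite isum_geometric; last by rewrite r1 ltW.
rewrite -EFinM; congr _%:E; field; apply/andP; split; lra.
Qed.

Lemma geometric_law_shift n (j k : int) : (`|k| <= n)%N ->
  rho ^+ n * geometric_law j <= geometric_law (j + k).
Proof.
have /andP[r0 r1] := rho01; move=> kn.
rewrite /geometric_law mulrCA ler_pM2l; last by rewrite divr_gt0//; lra.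
rewrite -exprD; apply: ler_wiXn2l; [exact: ltW|exact: ltW|].
by clear -kn; lia.
Qed.

End geometric_law.

Section mixing.
Variables (R : realType) (n : nat) (cb : int -> R).
Hypothesis cb0 : forall i, 0 <= cb i.

(** Mass and cost are linear in the law, and the divergence is jointly convex because [phi] is
    homogeneous and subadditive. *)
Lemma grid_mix (t B K B' K' : R) (q q' : int -> R) : 0 < t < 1 ->
  grid_mechanism n cb B K q -> grid_mechanism n cb B' K' q' ->
  grid_mechanism n cb (t * B + (1 - t) * B') (t * K + (1 - t) * K')
    (fun i => t * q i + (1 - t) * q' i).
Proof.
move=> /andP[t0 t1] [q0 q1 qc qd] [q'0 q'1 q'c q'd].
have t'0 : 0 < 1 - t by lra.
have linE (a b : int -> R) : (forall i, 0 <= a i) -> (forall i, 0 <= b i) ->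
    (\isum_i ((t * a i + (1 - t) * b i)%:E) =
     t%:E * (\isum_i ((a i)%:E)) + (1 - t)%:E * (\isum_i ((b i)%:E)))%E.
  move=> a0 b0.
  have ae0 i : (0 <= (a i)%:E)%E by rewrite lee_fin.
  have be0 i : (0 <= (b i)%:E)%E by rewrite lee_fin.
  rewrite -!isumZ ?ltW//.
  by rewrite -esumD// => i _; rewrite mule_ge0// lee_fin// ltW.
split.
- by move=> i; rewrite addr_gt0// mulr_gt0.
- rewrite linE; [|by move=> i; exact: ltW..].
  by rewrite q1 q'1 !mule1 -EFinD; congr _%:E; ring.
- under eq_esum => i _.
    rewrite (_ : _ * _ = t * (q i * cb i) + (1 - t) * (q' i * cb i)); last by ring.
    over.
  rewrite linE; [|by move=> i; rewrite mulr_ge0// ltW..].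
  rewrite [leRHS]EFinD !EFinM.
  by apply: leeD; apply: lee_wpmul2l; rewrite // lee_fin ltW.
- move=> k kn; rewrite [leRHS]EFinD !EFinM.
  apply: (@le_trans _ _ (t%:E * grid_div q k + (1 - t)%:E * grid_div q' k)%E).
    have p0 i : 0 <= phi (q i) (q (i - k)).
      by rewrite phi_ge0 ?ltW// => /eqP; rewrite gt_eqF.
    have p'0 i : 0 <= phi (q' i) (q' (i - k)).
      by rewrite phi_ge0 ?ltW// => /eqP; rewrite gt_eqF.
    rewrite /grid_div -linE//.
    apply: le_esum => i _; rewrite lee_fin.
    have tq0 i' : 0 < t * q i' by rewrite mulr_gt0.
    have tq'0 i' : 0 < (1 - t) * q' i' by rewrite mulr_gt0.
    rewrite -(phiZ (ltW t0) (ltW (q0 _)) (q0 _)).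
    rewrite -(phiZ (ltW t'0) (ltW (q'0 _)) (q'0 _)).
    apply: phiD; rewrite ?ltW//.
    + by move=> /eqP; rewrite gt_eqF.
    + by move=> /eqP; rewrite gt_eqF.
  apply: leeD; apply: lee_wpmul2l.
  + by rewrite lee_fin ltW.
  + exact: qd.
  + by rewrite lee_fin ltW.
  + exact: q'd.
Qed.

Lemma grid_reflect (B K : R) (q : int -> R) : (forall i, cb (- i) = cb i) ->
  grid_mechanism n cb B K q -> grid_mechanism n cb B K (fun i => q (- i)).
Proof.
move=> cbN [q0 q1 qc qd]; split => //.
- by rewrite (isum_opp (fun i => (q i)%:E)).
- under eq_esum do rewrite -cbN.
  by rewrite (isum_opp (fun i => (q i * cb i)%:E)).
- move=> k kn; rewrite /grid_div.
  under eq_esum do rewrite opprB addrC -[X in _ + X]opprK.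
  rewrite (isum_opp (fun i => (phi (q i) (q (i - - k)))%:E)).
  by apply: qd; rewrite abszN.
Qed.

(** Cactus densities depend on [|i|] only. Averaging [q] with its reflection costs nothing: the
    reflection exchanges the shifts [k] and [- k], which obey the same bound. *)
Lemma grid_symmetrize (B K : R) (q : int -> R) : (forall i, cb (- i) = cb i) ->
  grid_mechanism n cb B K q ->
  exists2 q', grid_mechanism n cb B K q' & forall i, q' (- i) = q' i.
Proof.
move=> cbN gq; have h : 0 < (2^-1 : R) < 1 by lra.
have := @grid_mix 2^-1 B K B K q _ h gq (grid_reflect cbN gq).
rewrite (_ : _ + _ = B); last by field.
rewrite (_ : _ + _ = K); last by field.
move=> gq'; exists (fun i => 2^-1 * q i + (1 - 2^-1) * q (- i)) => // i.
by rewrite opprK; field.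
Qed.

End mixing.

Lemma phiZ0 (R : realType) (t a b : R) : 0 <= t -> 0 <= a -> 0 <= b ->
  (b = 0 -> a = 0) -> phi (t * a) (t * b) = t * phi a b.
Proof.
move=> t0 a0; rewrite le_eqVlt => /predU1P[<- /(_ erefl) ->|b0 _].
  by rewrite mulr0 phi0l mulr0.
exact: phiZ.
Qed.

Lemma isum_ge_term (R : realType) (u : int -> \bar R) i :
  (forall i, 0 <= u i)%E -> (u i <= \isum_i (u i))%E.
Proof.
move=> u0; apply: esum_ge; exists [set i]; last by rewrite fsbig_set1.
by split => //; exact: finite_set1.
Qed.

Lemma isum_eq0 (R : realType) (u : int -> \bar R) :
  (forall i, 0 <= u i)%E -> (\isum_i (u i) = 0)%E -> forall i, (u i = 0)%E.
Proof.
move=> u0 su i; apply/eqP; rewrite eq_le u0 andbT -su.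
exact: isum_ge_term.
Qed.

(** * Averaging a family of laws over its inputs *)

Section grid_of_family.
Variables (R : realType) (n : nat) (cb : int -> R) (B K delta : R).
Variable a : int -> int -> R.
Hypotheses (n0 : (0 < n)%N) (delta0 : 0 < delta) (cb0 : forall i, 0 <= cb i).
Hypotheses (a0 : forall j m, 0 <= a j m)
  (a1 : forall j, (\isum_m ((a j m)%:E) = 1)%E)
  (ac : forall j, (\isum_m ((a j m * cb (m - j))%:E) <= B%:E)%E)
  (ad : forall j k : int, (`|k| <= n)%N ->
    (\isum_m ((phi (a j m) (a (j + k) m))%:E) <= K%:E)%E)
  (aac : forall j k m : int, (`|k| <= n)%N -> a (j + k) m = 0 -> a j m = 0).

Let rho : R := expR (- delta / n%:R).

Let rho01 : 0 < rho < 1.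
Proof.
rewrite expR_gt0/= /rho expR_lt1 mulNr oppr_lt0.
by apply: divr_gt0 => //; rewrite ltr0n.
Qed.

Let w := geometric_law rho.

Let w0 j : 0 < w j. Proof. exact: geometric_law_gt0. Qed.

Let w1 : (\isum_j ((w j)%:E) = 1)%E.
Proof. exact: isum_geometric_law. Qed.

Let wshift j k : (`|k| <= n)%N -> expR (- delta) * w j <= w (j + k).
Proof.
have -> : expR (- delta) = rho ^+ n.
  rewrite /rho -expRM_natl; congr expR; field.
  by rewrite pnatr_eq0 -lt0n.
exact: geometric_law_shift.
Qed.

Let wa (k j m : int) : (0 <= (w j * a (j + k) (m + j))%:E)%E.
Proof. by rewrite lee_fin mulr_ge0// ltW. Qed.

(** [s 0] is the law sought. In [s k] the rows are shifted but the weights are not, so Jensen's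
    inequality bounds the divergence of [s 0] from [s k]. The translate of [s 0] by [k] is the same
    sum with the weights shifted too, hence at least [expR (- delta)] times [s k]. *)
Let s k i : R := fine (\isum_j ((w j * a (j + k) (i + j))%:E)).

Let a_le1 j m : a j m <= 1.
Proof.
rewrite -lee_fin -(a1 j); apply: (isum_ge_term (u := fun m => (a j m)%:E)).
by move=> i; rewrite lee_fin.
Qed.

Let sE k i : (\isum_j ((w j * a (j + k) (i + j))%:E) = (s k i)%:E)%E.
Proof.
rewrite fineK// ge0_fin_numE; last exact: esum_ge0.
apply: (@le_lt_trans _ _ (\isum_j ((w j)%:E))); last by rewrite w1 ltry.
by apply: le_esum => j _; rewrite lee_fin ler_piMr// ltW.
Qed.

Let s_ge0 k i : 0 <= s k i.
Proof. by rewrite -lee_fin -sE; exact: esum_ge0. Qed.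

Let s_eq0 k i : s k i = 0 -> forall j, a (j + k) (i + j) = 0.
Proof.
move=> si j; have := sE k i; rewrite si => /isum_eq0 /(_ j) H.
have /eqP : w j * a (j + k) (i + j) = 0.
  by apply: EFin_inj; apply: H.
by rewrite mulf_eq0 gt_eqF//= => /eqP.
Qed.

(* Exchanging the two sums turns every average over [j] of the rows of [a]
   into the corresponding bound on a single row. *)
Let row_sum (u : int -> int -> R) (X : \bar R) : (forall j i, 0 <= u j i) ->
  (0 <= X)%E -> (forall j, \isum_i ((u j (i + j))%:E) <= X)%E ->
  (\isum_i (\isum_j ((w j * u j (i + j))%:E)) <= X)%E.
Proof.
move=> u0 X0 uX; rewrite isum_exchange; last first.
  by move=> i j; rewrite lee_fin mulr_ge0// ltW.
have ue0 j i : (0 <= (u j i)%:E)%E by rewrite lee_fin.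
apply: (@le_trans _ _ (\isum_j ((w j)%:E * X))); last first.
  under eq_esum do rewrite muleC.
  case: X X0 {uX} => [x||]// x0; last by rewrite leey.
  rewrite isumZ ?w1 ?mule1//.
  by move=> i; rewrite lee_fin ltW.
apply: le_esum => j _.
under eq_esum do rewrite EFinM.
rewrite (isumZ (ltW (w0 j)))//.
by apply: lee_wpmul2l => //; rewrite lee_fin ltW.
Qed.

Let s_sum k : (\isum_i ((s k i)%:E) = 1)%E.
Proof.
under eq_esum do rewrite -sE.
rewrite isum_exchange//.
under eq_esum => j _.
  under eq_esum do rewrite EFinM.
  rewrite (isumZ (ltW (w0 j))); last by move=> i; rewrite lee_fin.
  rewrite (isum_shift (fun i => (a (j + k) i)%:E)) a1 mule1.
  over.
exact: w1.
Qed.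

Let q := s 0.

Let qE i : (\isum_j ((w j * a j (i + j))%:E) = (q i)%:E)%E.
Proof. by rewrite -sE; apply: eq_esum => j _; rewrite addr0. Qed.

Let q_eq0 i : q i = 0 -> forall j, a j (i + j) = 0.
Proof. by move=> /s_eq0 + j => /(_ j); rewrite addr0. Qed.

Let q_eq0_of i : (forall j, a j (i + j) = 0) -> q i = 0.
Proof.
move=> h; apply: EFin_inj; rewrite -qE; apply: esum1 => j _.
by rewrite h mulr0.
Qed.

(** By [aac], a zero of [q] spreads to all cells at distance at most [n]. As [n >= 1], steps of 1
    and -1 reach every integer, against the total mass 1. *)
Let q_gt0 i : 0 < q i.
Proof.
rewrite lt0r s_ge0 andbT; apply/eqP => qi0.
have step i' k : (`|k| <= n)%N -> q i' = 0 -> q (i' - k) = 0.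
  move=> kn /q_eq0 h; apply: q_eq0_of => j.
  have e : i' - k + j = i' + (j - k) by ring.
  by rewrite e; apply: (@aac _ (- k)); rewrite ?abszN.
have up m : q (i + Posz m) = 0.
  elim: m => [|m IH]; first by rewrite addr0.
  have -> : i + Posz m.+1 = i + Posz m - (-1) by rewrite intS; ring.
  by apply: step.
have dn m : q (i - Posz m) = 0.
  elim: m => [|m IH]; first by rewrite subr0.
  have -> : i - Posz m.+1 = i - Posz m - 1 by rewrite intS; ring.
  by apply: step.
have q0 j : q j = 0.
  have -> : j = i + (j - i) by ring.
  case: (j - i) => m; first exact: up.
  by rewrite NegzE; exact: dn.
have := s_sum 0; rewrite esum1; last by move=> j _; rewrite -/q q0.
by move=> /eqP; rewrite eq_sym onee_eq0.
Qed.

Let s_gt0 k i : (`|k| <= n)%N -> 0 < s k i.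
Proof.
move=> kn; rewrite lt0r s_ge0 andbT; apply/eqP => /s_eq0 h.
suff : q i = 0 by apply/eqP; rewrite gt_eqF.
by apply: q_eq0_of => j; apply: (@aac _ k).
Qed.

Let phi_row j k m : (`|k| <= n)%N -> 0 <= phi (a j m) (a (j + k) m).
Proof. by move=> kn; rewrite phi_ge0//; exact: aac. Qed.

Let K0 : 0 <= K.
Proof.
rewrite -lee_fin; apply: le_trans (@ad 0 0 isT).
by apply: esum_ge0 => m _; rewrite lee_fin phi_row.
Qed.

Let div_s k : (`|k| <= n)%N ->
  (\isum_i ((phi (q i) (s k i))%:E) <= K%:E)%E.
Proof.
move=> kn.
apply: (@le_trans _ _
    (\isum_i (\isum_j ((w j * phi (a j (i + j)) (a (j + k) (i + j)))%:E)))).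
  apply: le_esum => i _.
  apply: (le_trans (@phi_esum _ (fun j => w j * a j (i + j))
    (fun j => w j * a (j + k) (i + j)) _ _ _ _ _ (qE i) (sE k i) _)).
  - by move=> j; rewrite mulr_ge0// ltW.
  - by move=> j; rewrite mulr_ge0// ltW.
  - move=> j /eqP; rewrite mulf_eq0 gt_eqF//= => /eqP.
    by move=> /aac ->//; rewrite mulr0.
  - by move=> /eqP; rewrite gt_eqF// s_gt0.
  - apply: le_esum => j _; rewrite (phiZ0 (ltW (w0 j)))//.
    exact: aac.
apply: (row_sum (u := fun j m => phi (a j m) (a (j + k) m))).
- by move=> j i; exact: phi_row.
- by rewrite lee_fin.
- move=> j.
  by rewrite (isum_shift (fun m => (phi (a j m) (a (j + k) m))%:E)) ad.
Qed.

Let q_shift k i : (`|k| <= n)%N -> expR (- delta) * s k i <= q (i - k).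
Proof.
move=> kn; rewrite -lee_fin EFinM -sE -qE -isumZ ?expR_ge0//.
rewrite -(isum_shift (fun j => (w j * a j (i - k + j))%:E) k).
apply: le_esum => j _; rewrite -EFinM lee_fin mulrA.
have -> : i - k + (j + k) = i + j by ring.
by rewrite ler_wpM2r// wshift.
Qed.

Lemma grid_of_family : exists q, grid_mechanism n cb B (K + delta) q.
Proof.
exists q; split.
- exact: q_gt0.
- exact: s_sum.
- have B0 : (0 <= B%:E)%E.
    by apply: le_trans (ac 0); apply: esum_ge0 => m _; rewrite lee_fin mulr_ge0.
  apply: (@le_trans _ _ (\isum_i (\isum_j
      ((w j * (a j (i + j) * cb (i + j - j)))%:E)))).
    apply: le_esum => i _; rewrite mulrC EFinM -qE -isumZ//; last first.
      by move=> j; rewrite lee_fin mulr_ge0// ltW.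
    apply: le_esum => j _; rewrite -EFinM lee_fin addrK; lra.
  apply: (row_sum (u := fun j m => a j m * cb (m - j))) => // [j i|j].
    exact: mulr_ge0.
  by rewrite (isum_shift (fun m => (a j m * cb (m - j))%:E)).
- move=> k kn.
  have p1 i : (0 <= (phi (q i) (q (i - k)))%:E)%E.
    rewrite lee_fin; apply: phi_ge0; rewrite ?(ltW (q_gt0 _))//.
    by move=> /eqP; rewrite gt_eqF.
  have p2 i : (0 <= (phi (q i) (s k i))%:E)%E.
    rewrite lee_fin; apply: phi_ge0; rewrite ?(ltW (q_gt0 _))//.
    by move=> /eqP; rewrite gt_eqF// s_gt0.
  have se0 k' i : (0 <= (s k' i)%:E)%E by rewrite lee_fin.
  have qe0 i : (0 <= (q (i - k))%:E)%E by rewrite lee_fin ltW.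
  have dq0 i : (0 <= (delta * q i)%:E)%E by rewrite lee_fin mulr_ge0 ?ltW.
  have q1 : (\isum_i ((q i)%:E) = 1)%E by exact: s_sum.
  (* The added 1 is the mass of [s k] on the left and that of the translate of [q] on the right: the
     linear terms of [phi] are compared without any subtraction in the extended reals. *)
  have H : (grid_div q k + 1 <= (K + delta)%:E + 1)%E.
    rewrite -{1}(s_sum k) /grid_div -esumD//.
    apply: (@le_trans _ _ (\isum_i ((phi (q i) (s k i))%:E +
        ((delta * q i)%:E + (q (i - k))%:E)))).
      apply: le_esum => i _; rewrite -!EFinD lee_fin /phi.
      have q0 := q_gt0 i; have s0 := s_gt0 i kn.
      have : ln (s k i) - delta <= ln (q (i - k)).
        rewrite -ler_expR expRD (lnK s0) (lnK (q_gt0 _)) mulrC.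
        exact: q_shift.
      rewrite -(ler_pM2l q0); nra.
    rewrite esumD//; last by move=> i _; rewrite adde_ge0.
    rewrite esumD// (isum_shift (fun i => (q i)%:E)) q1.
    under [X in (_ + (X + _))%E]eq_esum do rewrite EFinM.
    rewrite (isumZ (ltW delta0)); last by move=> i; rewrite lee_fin ltW.
    rewrite q1 mule1 EFinD -addeA leeD2r//.
    exact: div_s.
  by move: H; rewrite leeD2rE.
Qed.

End grid_of_family.

(** * Growth of the cost *)

(** Both errors are needed: [c] may vanish, which excludes a purely multiplicative one, and need not
    be uniformly continuous, which excludes a purely additive one. Compactness gives the additive
    error on a bounded interval, the power tail the multiplicative one beyond it. *)
Lemma cost_growth (R : realType) (c : R -> R) : cost_function c ->
  forall eta : R, 0 < eta -> exists2 delta : R, 0 < delta &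
    forall u v : R, `|u - v| <= delta -> c v <= (1 + eta) * c u + eta.
Proof.
case=> c0 c00 csym cmono ccont [al [be [al0 be0 ctail]]] eta eta0.
(* Small enough for [(1 + kap) * (1 + kap) <= (1 + eta) * (1 - kap)]. One [1 + kap] and the
   [1 - kap] come from the tail equivalence, the other [1 + kap] from the growth of the power
   between [x] and [x + d]. *)
pose kap : R := Num.min 1 eta / 8.
have [m0 m1 m2] : [/\ 0 < Num.min 1 eta, Num.min 1 eta <= 1 & Num.min 1 eta <= eta].
  by rewrite lt_min ltr01 eta0 !ge_min !lexx orbT.
have kap0 : 0 < kap by rewrite /kap; lra.
have kap1 : 1 < 1 + kap by rewrite ltrDl.
have [M [Mreal hM]] : \forall x \near +oo, `|1 - c x / (be * x `^ al)| < kap.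
  by move/cvgrPdist_lt: ctail => /(_ _ kap0).
pose L := Num.max 1 (M + 1).
have L1 : 1 <= L by rewrite le_max lexx.
have ML : M < L by rewrite lt_max ltrDl ltr01 orbT.
have Lc x : L <= x ->
    (1 - kap) * (be * x `^ al) <= c x <= (1 + kap) * (be * x `^ al).
  move=> Lx; have x0 : 0 < x by lra.
  have b0 : 0 < be * x `^ al by rewrite mulr_gt0// powR_gt0.
  have := hM x (lt_le_trans ML Lx); rewrite ltr_distlC => /andP[h1 h2].
  apply/andP; split.
    by rewrite -ler_pdivlMr//; lra.
  by rewrite -ler_pdivrMr//; lra.
have cnear : \forall d \near 0^'+,
    `[0, L] `<=` (fun x : R => c (x + d) <= c x + eta).
  have : compact `[0, L] by exact: segment_compact.
  move=> /compact_near_coveringP; apply => x _.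
  have h1 : \forall y \near x, `|c x - c y| < eta / 2.
    by have /cvgrPdist_lt := ccont x; apply; rewrite divr_gt0.
  have [e /= e0 he] := h1.
  exists (ball x (e / 2), [set d | 0 < d /\ d < e / 2]) => /=.
    split; first by apply: nbhsx_ballx; rewrite divr_gt0.
    near=> d; split; first by near: d; exact: nbhs_right_gt.
    by near: d; apply: nbhs_right_lt; rewrite divr_gt0.
  move=> [y d] /= [xy [d0 de]].
  have xy' : `|x - y| < e / 2 := xy.
  have := he y; have := he (y + d) => /= H1 H2.
  have {}H2 : `|c x - c y| < eta / 2 by apply: H2; rewrite /ball/=; lra.
  have {}H1 : `|c x - c (y + d)| < eta / 2.
    apply: H1; rewrite opprD addrA; apply: (le_lt_trans (ler_normB _ _)).
    by rewrite (gtr0_norm d0); lra.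
  by move: H1 H2; rewrite !ltr_distlC => /andP[? ?] /andP[? ?]; lra.
(* Beyond 1, [x + d <= (1 + d) * x], so this bound on [d] lets the power of exponent [al] grow by a
   factor at most [1 + kap]. *)
have dnear : \forall d \near 0^'+, d <= (1 + kap) `^ al^-1 - 1 :> R.
  apply: nbhs_right_le; rewrite subr_gt0 /powR (gt_eqF (lt_trans ltr01 kap1)).
  by rewrite expR_gt1 mulr_gt0 ?invr_gt0// ln_gt0.
have [d [d0 dc dk]] : exists d : R, [/\ 0 < d,
    `[0, L] `<=` (fun x : R => c (x + d) <= c x + eta) &
    d <= (1 + kap) `^ al^-1 - 1].
  near (0:R)^'+ => d; exists d; split; near: d => //.
  exact: nbhs_right_gt.
exists d => // u v uv.
have vle : c v <= c (`|u| + d).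
  apply: cmono; rewrite [X in _ <= X]ger0_norm; last by rewrite addr_ge0// ltW.
  rewrite -[v](subKr u); apply: (le_trans (ler_normB _ _)).
  by rewrite lerD2l.
have -> : c u = c `|u|.
  by apply/le_anti/andP; split; apply: cmono; rewrite normr_id.
apply: (le_trans vle); have u0 := normr_ge0 u; move: (`|u| : R) u0 => x x0 {uv vle}.
have [xL|Lx] := leP x L.
  have := dc x; rewrite /= in_itv/= x0 xL => /(_ isT) h.
  apply: (le_trans h); rewrite lerD2r mulrDl mul1r lerDl.
  by apply: mulr_ge0; [exact: ltW|exact: c0].
have /andP[h1 _] := Lc x (ltW Lx).
have /andP[_ h2] : (1 - kap) * (be * (x + d) `^ al) <= c (x + d) <=
    (1 + kap) * (be * (x + d) `^ al).
  by apply: Lc; lra.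
have x1 : 1 <= x by lra.
have h3 : (x + d) `^ al <= (1 + kap) * x `^ al.
  have -> : 1 + kap = ((1 + kap) `^ al^-1) `^ al.
    by rewrite -powRrM mulVf ?gt_eqF// powRr1//; lra.
  rewrite -powRM ?powR_ge0//.
  apply: ge0_ler_powR; rewrite ?(ltW al0)// ?nnegrE; first by rewrite addr_ge0// ltW.
    by rewrite mulr_ge0// powR_ge0.
  have : (1 + d) * x <= (1 + kap) `^ al^-1 * x by rewrite ler_wpM2r//; lra.
  nra.
have p0 := powR_ge0 x al; have q0 := powR_ge0 (x + d) al.
have cx0 := c0 x.
have kk : (1 + kap) * (1 + kap) <= (1 + eta) * (1 - kap).
  by rewrite /kap; move: m0 m1 m2; move: (Num.min 1 eta) => m *; nra.
have h4 : c (x + d) <= (1 + kap) * (1 + kap) * (be * x `^ al).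
  apply: (le_trans h2).
  have : be * (x + d) `^ al <= be * ((1 + kap) * x `^ al) by rewrite ler_pM2l.
  move=> h; apply: le_trans (_ : (1 + kap) * (be * ((1 + kap) * x `^ al)) <= _).
    by rewrite ler_pM2l//; lra.
  lra.
have bx0 : 0 <= be * x `^ al by rewrite mulr_ge0// ltW.
have h5 : (1 + kap) * (1 + kap) * (be * x `^ al) <=
    (1 + eta) * ((1 - kap) * (be * x `^ al)).
  by rewrite [leRHS]mulrA ler_wpM2r.
have h6 : (1 + eta) * ((1 - kap) * (be * x `^ al)) <= (1 + eta) * c x.
  by rewrite ler_wpM2l//; lra.
apply: (le_trans h4); apply: (le_trans h5); apply: (le_trans h6).
by rewrite lerDl ltW.
Unshelve. all: by end_near. Qed.

(** * Discretization of a mechanism *)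

Section grid_cells.
Variables (R : realType) (n : nat).
Hypothesis n0 : (0 < n)%N.

(** All closed on the left and open on the right, so that they are translates of one another, as
    recentring requires; the cells [cell n i] change convention with the sign of [i]. *)
Definition grid_cell (m : int) : set R :=
  [set x | Num.floor (n%:R * x + 2^-1) = m].

Let n0R : 0 < n%:R :> R. Proof. by rewrite ltr0n. Qed.

Lemma grid_cellP m x :
  grid_cell m x <-> m%:~R - 2^-1 <= n%:R * x < m%:~R + 2^-1.
Proof.
rewrite /grid_cell /=; split => [<-|/andP[h1 h2]].
  have := floor_itv (n%:R * x + 2^-1); rewrite intrD /=.
  by move=> /andP[h1 h2]; apply/andP; split; lra.
by apply: floor_def; rewrite intrD; apply/andP; split; lra.
Qed.

Lemma grid_cellE m :
  grid_cell m = `[(m%:~R - 2^-1) / n%:R, (m%:~R + 2^-1) / n%:R[%classic.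
Proof.
apply/seteqP; split => x /=; rewrite in_itv/=.
  by move/grid_cellP; rewrite ler_pdivrMr// ltr_pdivlMr// !(mulrC x).
by move=> h; apply/grid_cellP; rewrite !(mulrC n%:R) -ler_pdivrMr// -ltr_pdivlMr.
Qed.

Lemma measurable_grid_cell m : measurable (grid_cell m).
Proof. by rewrite grid_cellE; exact: measurable_itv. Qed.

Lemma trivIset_grid_cell : trivIset [set: int] grid_cell.
Proof. by move=> i j _ _ [x [<- <-]]. Qed.

Lemma bigcup_grid_cell : \bigcup_i grid_cell i = [set: R].
Proof.
by apply/seteqP; split => // x _; exists (Num.floor (n%:R * x + 2^-1)).
Qed.

Lemma grid_cell_shift m j x : grid_cell m x -> grid_cell (m - j) (x - j%:~R / n%:R).
Proof.
move/grid_cellP => /andP[h1 h2]; apply/grid_cellP.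
rewrite mulrBr (mulrC _ (_ / _)) divfK ?gt_eqF// intrB.
by apply/andP; split; lra.
Qed.

End grid_cells.

(* The value of [c] at a point whose absolute value dominates those of the
   points of the cell [i]. *)
Definition cell_cost (R : realType) (c : R -> R) (n : nat) (i : int) : R :=
  c (`|i|.+1%:R / n%:R).

Section cell_cost.
Variables (R : realType) (c : R -> R) (n : nat).
Hypotheses (hc : cost_function c) (n0 : (0 < n)%N).

Let n0R : 0 < n%:R :> R. Proof. by rewrite ltr0n. Qed.

Lemma cell_cost_ge0 i : 0 <= cell_cost c n i.
Proof. exact: cost_ge0. Qed.

Lemma cell_costN i : cell_cost c n (- i) = cell_cost c n i.
Proof. by rewrite /cell_cost abszN. Qed.

Let absM (x : R) : n%:R * `|x| = `|n%:R * x|.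
Proof. by rewrite normrM (ger0_norm (ltW n0R)). Qed.

Let absi (i : int) : `|i|.+1%:R = `|i%:~R| + 1 :> R.
Proof. by rewrite -natr1 -intr_norm natr_absz. Qed.

Lemma cell_cost_ge (i : int) x : i%:~R - 2^-1 <= n%:R * x <= i%:~R + 2^-1 ->
  c x <= cell_cost c n i.
Proof.
move=> /andP[h1 h2]; apply: cost_mono => //.
rewrite [leRHS]ger0_norm ?divr_ge0// ler_pdivlMr// mulrC absM absi.
rewrite ler_norml; have := ler_norm (i%:~R : R); have := ler_normr (i%:~R : R) 0.
by have := ler_norm (- i%:~R : R); rewrite normrN => *; apply/andP; split; lra.
Qed.

(** The point defining [cell_cost] is [(|i| + 1) / n], and [|x|] is within [1 / (2 * n)] of
    [|i| / n]: the distance is at most [3 / (2 * n)], below [2 / n]. *)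
Lemma cell_cost_le (eta : R) i x :
  (forall u v, `|u - v| <= 2 / n%:R -> c v <= (1 + eta) * c u + eta) ->
  grid_cell n i x -> cell_cost c n i <= (1 + eta) * c x + eta.
Proof.
move=> hn /(grid_cellP n) /andP[h1 h2].
have -> : c x = c `|x|.
  by apply/le_anti/andP; split; apply: cost_mono => //; rewrite normr_id.
apply: hn; rewrite ler_pdivlMr// -{2}(ger0_norm (ltW n0R)) -normrM.
rewrite mulrBl divfK ?gt_eqF// mulrC absM absi.
have := ler_dist_dist (n%:R * x) i%:~R.
have h : `|n%:R * x - i%:~R| <= 2^-1 by rewrite ler_norml; apply/andP; split; lra.
move=> h'; rewrite ler_norml; move: (le_trans h' h); rewrite ler_norml.
by move=> /andP[? ?]; apply/andP; split; lra.
Qed.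

(** Adding 1 to the cost absorbs the additive error: [(1 + eta) * u + eta + 1] is
    [(1 + eta) * (u + 1)], so iteration yields plain powers. *)
Lemma cell_cost_succ (eta : R) m : 0 <= eta ->
  (forall u v, `|u - v| <= 2 / n%:R -> c v <= (1 + eta) * c u + eta) ->
  cell_cost c n (Posz m.+1) + 1 <= (1 + eta) * (cell_cost c n (Posz m) + 1).
Proof.
move=> eta0 hn; rewrite /cell_cost /=.
have := hn (m.+1%:R / n%:R) (m.+2%:R / n%:R).
have -> : `|m.+1%:R / n%:R - m.+2%:R / n%:R| = n%:R^-1 :> R.
  rewrite -mulrBl -[m.+2%:R]natr1 opprD addrA subrr add0r mulN1r normrN.
  by rewrite ger0_norm// invr_ge0 ltW.
have : (n%:R)^-1 <= 2 / n%:R :> R.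
  by rewrite -[leLHS]mul1r ler_pM2r ?invr_gt0//; lra.
by move=> h /(_ h) {h}; lra.
Qed.

End cell_cost.

Lemma KL_dominates d (T : measurableType d) (R : realType)
  (P Q : probability T R) (K : R) : (KL P Q <= K%:E)%E -> P `<< Q.
Proof. by rewrite /KL; case: asboolP. Qed.

Section grid_of_mechanism.
Variables (R : realType) (c : R -> R) (P : R -> probability R R) (C K : R).
Hypothesis hc : cost_function c.
Hypothesis hC : forall x, (\int[P x]_y (c (y - x))%:E <= C%:E)%E.
Hypothesis hK : forall x x', `|x - x'| <= 1 -> (KL (P x) (P x') <= K%:E)%E.

(** Row [j] of the family is the law for the input [j / n], read on the cells. When [y] is in cell
    [m], [y - j / n] is in cell [m - j], which gives the cost; inputs [k] steps apart with
    [|k| <= n] are at distance at most 1, which gives the divergence. *)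
Lemma grid_of_mechanism n (eta delta : R) : (0 < n)%N -> 0 <= eta -> 0 < delta ->
  (forall u v, `|u - v| <= 2 / n%:R -> c v <= (1 + eta) * c u + eta) ->
  exists q, grid_mechanism n (cell_cost c n) ((1 + eta) * C + eta)
    (K + delta) q.
Proof.
move=> n0 eta0 delta0 hn.
have n0R : 0 < n%:R :> R by rewrite ltr0n.
pose E := @grid_cell R n.
have mE m : measurable (E m) by exact: measurable_grid_cell.
have tE : trivIset setT E by exact: trivIset_grid_cell.
have cE : \bigcup_i E i = setT by exact: bigcup_grid_cell.
pose a (j m : int) : R := fine (P (j%:~R / n%:R) (E m)).
have aE j m : ((a j m)%:E = P (j%:~R / n%:R) (E m))%E.
  by rewrite fineK// fin_num_measure//; exact: mE.
have near1 (j k : int) : (`|k| <= n)%N ->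
    `|j%:~R / n%:R - (j + k)%:~R / n%:R| <= 1 :> R.
  move=> kn; rewrite -mulrBl intrD opprD addrA subrr sub0r normrM normrN.
  have ni0 : 0 <= n%:R^-1 :> R by rewrite invr_ge0 ltW.
  rewrite (ger0_norm ni0).
  by rewrite ler_pdivrMr// mul1r -intr_norm -natr_absz ler_nat.
have mc : measurable_fun setT c.
  exact: continuous_measurable_fun (cost_continuous hc).
apply: (@grid_of_family _ _ _ _ _ _ a) => //.
- exact: cell_cost_ge0.
- by move=> j m; rewrite -lee_fin aE.
- move=> j; under eq_esum do rewrite aE.
  transitivity (\int[P (j%:~R / n%:R)]_x (cst 1%E x))%E; last first.
    by rewrite integral_cst//= mul1e probability_setT.
  rewrite (integral_partition_int _ mE)//.
  by apply: eq_esum => m _; rewrite integral_cst ?mul1e//; exact: mE.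
- move=> j; set x := (j%:~R / n%:R : R).
  have mcx : measurable_fun setT (fun y : R => (c (y - x))%:E).
    apply/measurable_EFinP; apply: measurableT_comp => //.
    exact: measurable_funB.
  have cx0 y : (0 <= (c (y - x))%:E)%E by rewrite lee_fin; exact: cost_ge0.
  have e1 : 0 <= 1 + eta by rewrite addr_ge0.
  apply: (@le_trans _ _
      (\int[P x]_y ((1 + eta)%:E * (c (y - x))%:E + eta%:E)%E)%E); last first.
    rewrite ge0_integralD//; first last.
    + exact: measurable_funeM.
    + by move=> y _; rewrite mule_ge0.
    rewrite ge0_integralZl//.
    have -> : (\int[P x]_y (cst eta%:E y) = eta%:E)%E.
      by rewrite integral_cst//= probability_setT mule1.
    rewrite [leRHS]EFinD EFinM; apply: leeD => //.
    by apply: lee_wpmul2l; rewrite ?hC.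
  rewrite (integral_partition_int _ mE)//; first last.
  + by move=> y; rewrite adde_ge0// mule_ge0.
  + by apply: emeasurable_funD => //; exact: measurable_funeM.
  apply: le_esum => m _; rewrite mulrC EFinM aE -integral_cst; last exact: mE.
  apply: ge0_le_integral => //=.
  + by move=> y _; rewrite lee_fin cell_cost_ge0.
  + apply: measurable_funTS; apply: emeasurable_funD => //.
    exact: measurable_funeM.
  + move=> y Ey; rewrite -EFinM -EFinD lee_fin.
    by apply: (cell_cost_le hc n0 hn); exact: grid_cell_shift.
- move=> j k kn; apply: le_trans (hK (near1 j k kn)).
  apply: (data_processing mE) => //.
  exact: KL_dominates (hK (near1 j k kn)).
- move=> j k m kn a0.
  have /KL_dominates/null_content_dominatesP := hK (near1 j k kn).
  move=> /(_ _ (mE m)) h; rewrite /a h//.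
  by have := aE (j + k) m; rewrite a0.
Qed.

End grid_of_mechanism.

Lemma exists_inv_le (R : realType) (x : R) : 0 < x ->
  exists2 k : nat, (0 < k)%N & k%:R^-1 <= x.
Proof.
move=> x0; exists (Num.truncn x^-1).+1 => //.
rewrite -[leRHS]invrK lef_pV2 ?posrE ?invr_gt0//.
by apply: ltW; rewrite truncnS_gt.
Qed.

(** A pointwise bound [delta] on the log-likelihood ratio bounds its mean. *)
Lemma grid_div_le (R : realType) (q : int -> R) (k : int) (delta : R) :
  0 <= delta -> (forall i, 0 < q i) -> (\isum_i ((q i)%:E) = 1)%E ->
  (forall i, expR (- delta) * q i <= q (i - k)) ->
  (grid_div q k <= delta%:E)%E.
Proof.
move=> d0 q0 q1 qk.
have qe0 i : (0 <= (q i)%:E)%E by rewrite lee_fin ltW.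
have p0 i : (0 <= (phi (q i) (q (i - k)))%:E)%E.
  rewrite lee_fin; apply: phi_ge0; rewrite ?(ltW (q0 _))//.
  by move=> /eqP; rewrite gt_eqF.
have dq0 i : (0 <= (delta * q i)%:E)%E.
  by rewrite lee_fin; apply: mulr_ge0 => //; exact: ltW.
have H : (grid_div q k + 1 <= delta%:E + 1)%E.
  rewrite -{1}q1 /grid_div -esumD//.
  apply: (@le_trans _ _ (\isum_i ((delta * q i)%:E + (q (i - k))%:E))).
    apply: le_esum => i _; rewrite -!EFinD lee_fin /phi.
    have : ln (q i) - delta <= ln (q (i - k)).
      rewrite -ler_expR expRD (lnK (q0 i)) (lnK (q0 (i - k))) mulrC.
      exact: qk.
    by rewrite -(ler_pM2l (q0 i)); nra.
  rewrite esumD// (isum_shift (fun i => (q i)%:E)) q1.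
  under [X in (X + _)%E]eq_esum do rewrite EFinM.
  by rewrite isumZ// q1 mule1.
by move: H; rewrite leeD2rE.
Qed.

(** [1 - s ^+ L] is [1 - s] times a sum of [L] powers, each at least [s ^+ L]. It will bound
    [(1 - s ^+ L.+1) / (1 - s ^+ L)] by [1 + 1 / L] uniformly in [s], hence in the mesh. *)
Lemma mul_expr_le (R : realType) (s : R) (L : nat) : 0 < s <= 1 ->
  L%:R * (s ^+ L * (1 - s)) <= 1 - s ^+ L.
Proof.
move=> /andP[s0 s1]; elim: L => [|L IH]; first by rewrite mul0r expr0 subrr.
have h : s ^+ L.+1 * (1 - s) <= s ^+ L * (1 - s).
  rewrite exprS ler_wpM2r ?subr_ge0// ler_piMl// exprn_ge0//; exact: ltW.
have h2 : L%:R * (s ^+ L.+1 * (1 - s)) <= L%:R * (s ^+ L * (1 - s)).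
  by rewrite ler_wpM2l.
have e : 1 - s ^+ L.+1 = (1 - s ^+ L) + s ^+ L * (1 - s) by rewrite exprS; ring.
by rewrite e -natr1 mulrDl mul1r; lra.
Qed.

(** On the mesh [1 / n0] the cost plus one grows by at most [b] per step, hence essentially by
    [t = b ^ (1 / m)] per cell of the finer mesh. A decay [t ^ - (L + 1)] per cell beats this
    growth, and over a unit length it amounts to a factor that does not involve [m]. *)
Lemma geometric_mechanism (R : realType) (c : R -> R) (C : R) :
  cost_function c -> 0 < C ->
  exists (n0 : nat) (K0 : R), [/\ (0 < n0)%N, 0 <= K0 &
    forall m, (0 < m)%N ->
      exists g, grid_mechanism (n0 * m) (cell_cost c (n0 * m)) C K0 g].
Proof.
(* The mean of the cost plus one will be bounded by [(1 + eta) ^ 3], which this choice keeps below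
   [1 + C]. *)
move=> hc C0; pose eta : R := Num.min 1 C / 8.
have [m0 m1 m2] : [/\ 0 < Num.min 1 C, Num.min 1 C <= 1 & Num.min 1 C <= C].
  by rewrite lt_min ltr01 C0 !ge_min !lexx orbT.
have [eta0 eta1 etaC] : [/\ 0 < eta, eta <= 8^-1 & 8 * eta <= C].
  by rewrite /eta; split; lra.
have [delta delta0 hdelta] := cost_growth hc eta0.
have [n0 n00 hn0] := exists_inv_le delta0; have [L L0 hL] := exists_inv_le eta0.
pose b := 1 + eta; have b1 : 1 < b by rewrite /b; lra.
have lnb0 : 0 < ln b by rewrite ln_gt0.
exists n0, ((L.+1 * n0)%:R * ln b); split => //.
  by rewrite mulr_ge0// ltW.
move=> m m0'; have mR : 0 < m%:R :> R by rewrite ltr0n.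
have n0R : 0 < n0%:R :> R by rewrite ltr0n.
have cpow j : c (j%:R / n0%:R) + 1 <= b ^+ j.
  elim: j => [|j IH]; first by rewrite mul0r (cost0 hc) add0r expr0.
  have h : `|j%:R / n0%:R - j.+1%:R / n0%:R| <= delta.
    rewrite -mulrBl -[j.+1%:R]natr1 opprD addrA subrr add0r mulN1r normrN.
    by rewrite ger0_norm// invr_ge0 ltW.
  have := hdelta _ _ h; rewrite exprS.
  have : b * (c (j%:R / n0%:R) + 1) <= b * b ^+ j.
    by rewrite ler_pM2l//; lra.
  by rewrite /b; lra.
pose t := expR (ln b / m%:R); have t1 : 1 < t by rewrite expR_gt1 divr_gt0.
have t0 : 0 < t by exact: expR_gt0.
have tm : t ^+ m = b.
  rewrite /t -expRM_natl mulrC divfK ?gt_eqF// lnK// posrE; lra.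
have tb : t <= b by rewrite -tm -[leLHS]expr1 ler_weXn2l// ltW.
have cellb i : cell_cost c (n0 * m) i + 1 <= b * t ^+ `|i|.
  apply: (@le_trans _ _ (b ^+ (`|i| %/ m).+1)).
    apply: le_trans (cpow _); rewrite lerD2r; apply: (cost_mono hc).
    rewrite !ger0_norm ?divr_ge0// ler_pdivrMr ?ltr0n ?muln_gt0 ?n00//.
    rewrite natrM mulrA divfK ?gt_eqF// -natrM ler_nat.
    by rewrite ltn_ceil.
  rewrite exprS ler_pM2l; last by lra.
  rewrite -tm -exprM; apply: ler_weXn2l; first exact: ltW.
  by rewrite mulnC leq_trunc_div.
pose s := t^-1; have s0 : 0 < s by rewrite invr_gt0.
have s1 : s < 1 by rewrite invf_lt1.
(* The extra exponent pays for the growth [t]: [rho * t = s ^+ L], so the cost sums as a geometric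
   series almost as large as that of the masses. *)
pose rho := s ^+ L.+1.
have rho01 : 0 < rho < 1.
  by rewrite exprn_gt0//= exprn_ilt1// ltW.
have rhot : rho * t = s ^+ L by rewrite /rho exprSr -mulrA mulVf ?mulr1// gt_eqF.
have [g0 gsum] := (geometric_law_gt0 rho01, isum_geometric_law rho01).
exists (geometric_law rho); split => //.
- have x01 : 0 < s ^+ L < 1 by rewrite exprn_gt0//= exprn_ilt1 ?ltW// -lt0n.
  have /andP[x0 x1] := x01; have /andP[r0 r1] := rho01.
  have H : (\isum_i ((geometric_law rho i * cell_cost c (n0 * m) i)%:E) + 1 <=
      C%:E + 1)%E.
    rewrite -{1}gsum -esumD//; last 2 first.
    - move=> i _; rewrite lee_fin; apply: mulr_ge0; first exact: ltW.
      exact: cell_cost_ge0.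
    - by move=> i _; rewrite lee_fin ltW.
    apply: (@le_trans _ _ (\isum_i (((1 - rho) / (1 + rho) * b)%:E *
        ((s ^+ L) ^+ `|i|)%:E))).
      apply: le_esum => i _; rewrite -EFinD -EFinM lee_fin.
      rewrite -[X in _ + X]mulr1 -mulrDr -rhot exprMn.
      rewrite (_ : _ * (_ * _) = geometric_law rho i * (b * t ^+ `|i|)); last first.
        by rewrite /geometric_law; ring.
      by rewrite ler_pM2l.
    rewrite isumZ; last 2 first.
    - by rewrite mulr_ge0 ?divr_ge0//; lra.
    - by move=> i; rewrite lee_fin exprn_ge0// ltW.
    rewrite isum_geometric; last by rewrite x1 ltW.
    rewrite -EFinM -EFinD lee_fin.
    have f1 : (1 - rho) / (1 - s ^+ L) <= 1 + eta.
      rewrite ler_pdivrMr ?subr_gt0//.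
      have := @mul_expr_le _ s L; rewrite s0 ltW// => /(_ isT) h.
      have h' : s ^+ L * (1 - s) <= eta * (1 - s ^+ L).
        have LR : 0 < L%:R :> R by rewrite ltr0n.
        apply: le_trans (_ : L%:R^-1 * (1 - s ^+ L) <= _).
          by rewrite -(ler_pM2l LR) mulVKf// gt_eqF.
        by rewrite ler_wpM2r// subr_ge0 ltW.
      by rewrite /rho exprSr; lra.
    have f2 : (1 + s ^+ L) / (1 + rho) <= b.
      apply: le_trans tb; rewrite ler_pdivrMr; last by lra.
      by rewrite mulrDr mulr1 (mulrC t) rhot; lra.
    have -> : (1 - rho) / (1 + rho) * b * ((1 + s ^+ L) / (1 - s ^+ L)) =
        b * ((1 - rho) / (1 - s ^+ L)) * ((1 + s ^+ L) / (1 + rho)).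
      by move: (s ^+ L) (rho) (b) => *; rewrite -!mulrA; ring.
    have f10 : 0 <= (1 - rho) / (1 - s ^+ L) by rewrite divr_ge0//; lra.
    have f20 : 0 <= (1 + s ^+ L) / (1 + rho) by rewrite divr_ge0//; lra.
    apply: (@le_trans _ _ (b * b * b)).
      apply: ler_pM => //; first by rewrite mulr_ge0//; lra.
      by rewrite ler_pM2l//; lra.
    by rewrite /b; nra.
  by move: H; rewrite leeD2rE.
- move=> k kn; apply: grid_div_le => //.
    by rewrite mulr_ge0// ltW.
  move=> i.
  (* [rho ^+ (n0 * m)] is [b ^ - ((L + 1) * n0)]: the [m] cancels, whence a bound uniform in the
     mesh. *)
  have -> : expR (- ((L.+1 * n0)%:R * ln b)) = rho ^+ (n0 * m).
    rewrite /rho /s /t -expRN -!exprM -expRM_natl; congr expR.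
    by rewrite !natrM; field; rewrite gt_eqF.
  by apply: geometric_law_shift => //; rewrite abszN.
Qed.

(** * Geometric tails *)

Section truncation_pointwise.
Variables (R : realType) (n N : nat) (q : nat -> R) (g : R).
Hypotheses (q0 : forall m, 0 < q m).
Hypothesis hg : forall a, (a <= n)%N ->
  [/\ q (N - a)%N <= g, phi (q (N - a)%N) (q N) <= g &
      phi (q N) (q (N - a)%N) <= g].

Definition truncation (x : nat) : R :=
  if (x < N)%N then q x else q N * 2^-1 ^+ (x - N).

Let s : R := 2^-1.
Let s0 : 0 < s. Proof. by rewrite invr_gt0. Qed.
Let se0 k : 0 < s ^+ k. Proof. exact: exprn_gt0. Qed.
Let s1 : s <= 1. Proof. by rewrite invf_le1// ler1n. Qed.
Let se1 k : s ^+ k <= 1. Proof. by rewrite exprn_ile1// ltW. Qed.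

Lemma truncation_le x : (x <= N)%N -> truncation x = q x.
Proof.
rewrite leq_eqVlt => /predU1P[->|xN]; rewrite /truncation ?xN//.
by rewrite ltnn subnn mulr1.
Qed.

Lemma truncation_ge x : (N <= x)%N -> truncation x = q N * s ^+ (x - N).
Proof. by rewrite /truncation ltnNge => ->. Qed.

Lemma truncation_gt0 x : 0 < truncation x.
Proof. by rewrite /truncation; case: ifP => // _; rewrite mulr_gt0. Qed.

Let l0 : 0 <= ln (2 : R). Proof. by rewrite ln_ge0 ?ler1n. Qed.

Let l1 : ln (2 : R) <= 1.
Proof. by have := @le_ln1Dx R 1; rewrite -natr1; apply; lra. Qed.

Let lns k : ln (s ^+ k) = - (k%:R * ln 2).
Proof. by rewrite lnXn// /s lnV ?posrE// mulNrn mulr_natl. Qed.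

Let lnqs k : ln (q N * s ^+ k) = ln (q N) - k%:R * ln 2.
Proof. by rewrite lnM ?posrE// lns. Qed.

Let s_le a b : (b <= a + n)%N -> s ^+ a <= 2 ^+ n * s ^+ b.
Proof.
move=> ban.
have e : 2 ^+ n * s ^+ n = 1 by rewrite -exprMn divff// expr1n.
have -> : s ^+ a = 2 ^+ n * s ^+ (n + a) by rewrite exprD mulrA e mul1r.
rewrite ler_pM2l ?exprn_gt0//.
by apply: ler_wiXn2l; rewrite ?(ltW s0)// addnC.
Qed.

Let g0 : 0 < g.
Proof. by have [h _ _] := hg (leq0n n); apply: lt_le_trans h; exact: q0. Qed.

(** Nothing changes when [x + n < N]. Otherwise the cases are whether [x] and [y] lie beyond the
    cut. In the constant, [n] bounds the change of logarithm over [n] steps since [ln 2 <= 1], and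
    [2 ^+ n] the ratio of two tail values [n] steps apart. The natural subtraction [x - N] is 0
    before the cut. *)
Lemma phi_truncation x y : (x <= y + n)%N -> (y <= x + n)%N ->
  phi (truncation x) (truncation y) <= phi (q x) (q y) +
    (if (x + n < N)%N then 0 else (n%:R + 1 + 2 ^+ n) * g * s ^+ (x - N)).
Proof.
move=> xy yx.
have p0 : 0 <= phi (q x) (q y).
  by apply: phi_ge0; rewrite ?ltW// => /eqP; rewrite gt_eqF.
have p2 : 1 <= 2 ^+ n :> R by rewrite exprn_ege1// ler1n.
have r0 : 0 <= (n%:R + 1 + 2 ^+ n) * g * s ^+ (x - N).
  by rewrite !mulr_ge0 ?addr_ge0 ?exprn_ge0// ltW.
case: ifPn => [xnN|].
  by rewrite !truncation_le ?addr0//; lia.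
rewrite -leqNgt => Nxn.
have nl : n%:R * ln 2 <= n%:R :> R by rewrite ler_piMr.
have [xN|Nx] := leqP x N; have [yN|Ny] := leqP y N.
- by rewrite !truncation_le// lerDl.
- rewrite truncation_le// truncation_ge; last exact: ltnW.
  apply: le_trans (_ : (n%:R + 1 + 2 ^+ n) * g * s ^+ (x - N) <= _); last first.
    by rewrite lerDr.
  have -> : (x - N = 0)%N by lia.
  rewrite expr0 mulr1.
  have xE : x = (N - (N - x))%N by lia.
  have [h1 h2 _] : [/\ q x <= g, phi (q x) (q N) <= g & phi (q N) (q x) <= g].
    by rewrite xE; apply: hg; lia.
  move: h2; rewrite /phi lnqs => h2.
  have h3 : (y - N)%:R * ln 2 <= n%:R :> R.
    by apply: le_trans nl; rewrite ler_wpM2r// ler_nat; lia.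
  have h4 : q x * ((y - N)%:R * ln 2) <= n%:R * g.
    rewrite mulrC; apply: ler_pM => //; last exact: ltW.
    by rewrite mulr_ge0.
  have h5 : q N * s ^+ (y - N) <= q N by rewrite ler_piMr// ltW.
  have h6 : 0 <= (2 ^+ n) * g by rewrite mulr_ge0 ?exprn_ge0// ltW.
  lra.
- rewrite (truncation_le yN) truncation_ge; last exact: ltnW.
  apply: le_trans (_ : (n%:R + 1 + 2 ^+ n) * g * s ^+ (x - N) <= _); last first.
    by rewrite lerDr.
  have yE : y = (N - (N - y))%N by lia.
  have [h1 _ h2] : [/\ q y <= g, phi (q y) (q N) <= g & phi (q N) (q y) <= g].
    by rewrite yE; apply: hg; lia.
  have h3 : phi (q N * s ^+ (x - N)) (q y) <=
      s ^+ (x - N) * phi (q N) (q y) + q y * (1 - s ^+ (x - N)).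
    rewrite /phi lnqs.
    have : 0 <= q N * s ^+ (x - N) * ((x - N)%:R * ln 2).
      by rewrite !mulr_ge0// ltW.
    lra.
  have h4 : q y <= 2 ^+ n * g * s ^+ (x - N).
    have : 1 <= 2 ^+ n * s ^+ (x - N).
      by rewrite -(expr0 s); apply: s_le; lia.
    move=> h; rewrite -[leLHS]mul1r mulrAC.
    apply: ler_pM => //; exact: ltW.
  have h5 : s ^+ (x - N) * phi (q N) (q y) <= g * s ^+ (x - N).
    by rewrite mulrC ler_pM2r.
  have h6 : 0 <= n%:R * g * s ^+ (x - N) by rewrite !mulr_ge0// ltW.
  have h7 : 0 <= q y * s ^+ (x - N) by rewrite mulr_ge0// ltW.
  lra.
- rewrite !truncation_ge; [|exact: ltnW..].
  apply: le_trans (_ : (n%:R + 1 + 2 ^+ n) * g * s ^+ (x - N) <= _); last first.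
    by rewrite lerDr.
  have qNg : q N <= g by have [h _ _] := hg (leq0n n); rewrite subn0 in h.
  rewrite (phiZ (ltW (q0 N)) (ltW (se0 _)) (se0 _)).
  have h : phi (s ^+ (x - N)) (s ^+ (y - N)) <=
      (n%:R + 1 + 2 ^+ n) * s ^+ (x - N).
    rewrite /phi !lns.
    have h1 : s ^+ (y - N) <= 2 ^+ n * s ^+ (x - N) by apply: s_le; lia.
    have h2 : (y - N)%:R * ln 2 <= n%:R + (x - N)%:R * ln 2 :> R.
      apply: le_trans (_ : (n + (x - N))%:R * ln 2 <= _).
        by rewrite ler_wpM2r// ler_nat; lia.
      by rewrite natrD mulrDl lerD2r.
    have : s ^+ (x - N) * (- ((x - N)%:R * ln 2) - - ((y - N)%:R * ln 2)) <=
        s ^+ (x - N) * n%:R by rewrite ler_pM2l//; lra.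
    have := se0 (x - N); lra.
  apply: le_trans (_ : q N * ((n%:R + 1 + 2 ^+ n) * s ^+ (x - N)) <= _).
    by rewrite ler_pM2l.
  rewrite mulrCA mulrA ler_pM2r// ler_pM2l//; lra.
Qed.

End truncation_pointwise.

Section grid_truncation.
Variables (R : realType) (n : nat) (cb : int -> R) (B K : R) (q : int -> R).
Hypotheses (cb0 : forall i, 0 <= cb i) (cbN : forall i, cb (- i) = cb i).
Hypothesis cbS : forall m,
  cb (Posz m.+1) + 1 <= (1 + 2^-1) * (cb (Posz m) + 1).
Hypotheses (hq : grid_mechanism n cb B K q) (qN : forall i, q (- i) = q i).

Let q0 i : 0 < q i. Proof. exact: grid_gt0 hq i. Qed.

Let abs_even (u : int -> R) i : (forall i, u (- i) = u i) -> u i = u `|i|%N.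
Proof. by case: i => // m uN; rewrite NegzE abszN uN. Qed.

Let peak (s : R) (N : nat) (i : int) : R :=
  s ^+ `|i + - Posz N| + s ^+ `|i + Posz N|.

Let peak_ge0 (s : R) N i : 0 <= s -> 0 <= peak s N i.
Proof. by move=> s0; rewrite addr_ge0// exprn_ge0. Qed.

Let isum_peak (s : R) N : 0 <= s < 1 ->
  (\isum_i ((peak s N i)%:E) = (2 * ((1 + s) / (1 - s)))%:E)%E.
Proof.
move=> /[dup] /andP[s0 s1] s01; under eq_esum do rewrite EFinD.
rewrite esumD; [|by move=> i _; rewrite lee_fin exprn_ge0..].
rewrite (isum_shift (fun i => (s ^+ `|i|)%:E) (- Posz N)).
rewrite (isum_shift (fun i => (s ^+ `|i|)%:E) (Posz N)).
by rewrite isum_geometric// -EFinD; congr _%:E; ring.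
Qed.

(* [peak] dominates the two one-sided geometric tails starting at [N] and at
   [- N], and its sum over the integers comes from shift invariance. *)
Let peak_ge (s : R) N i : 0 < s <= 1 -> (N <= `|i|)%N ->
  s ^+ (`|i| - N) <= peak s N i.
Proof.
move=> /andP[s0 s1]; case: i => m; rewrite /peak => Nm.
  have -> : `|(Posz m + - Posz N)%R|%N = (`|Posz m| - N)%N by lia.
  by rewrite lerDl exprn_ge0// ltW.
have -> : `|(Negz m + Posz N)%R|%N = (`|Negz m| - N)%N by lia.
by rewrite lerDr exprn_ge0// ltW.
Qed.

Let peak_near (s : R) N i : 0 < s <= 1 -> (N <= `|i| + n)%N -> (`|i| <= N)%N ->
  s ^+ n <= peak s N i.
Proof.
move=> /andP[s0 s1]; case: i => m; rewrite /peak => Nm mN.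
  apply: le_trans (_ : s ^+ `|(Posz m + - Posz N)%R| <= _).
    by apply: ler_wiXn2l; [exact: ltW|exact: s1|lia].
  by rewrite lerDl exprn_ge0// ltW.
apply: le_trans (_ : s ^+ `|(Negz m + Posz N)%R| <= _).
  by apply: ler_wiXn2l; [exact: ltW|exact: s1|lia].
by rewrite lerDr exprn_ge0// ltW.
Qed.

Let B0 : 0 <= B.
Proof.
rewrite -lee_fin; apply: le_trans (grid_cost hq).
by apply: esum_ge0 => i _; rewrite lee_fin mulr_ge0// ltW.
Qed.

Let p0 i k : 0 <= phi (q i) (q (i - k)).
Proof. by apply: phi_ge0; rewrite ?(ltW (q0 _))// => /eqP; rewrite gt_eqF. Qed.

Let K0 : 0 <= K.
Proof.
rewrite -lee_fin; apply: le_trans (grid_divergence hq (k := 0) isT).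
by apply: esum_ge0 => i _; rewrite lee_fin.
Qed.

(** Everything that must be small at the cut: the mass with its cost, and for each [a <= n] the
    divergence terms between [i - a] and [i] in both directions. Its sum is finite by the bounds on
    cost and divergence, so it is arbitrarily small far out. *)
Let G (i : int) : R := q i * (cb i + 1) +
  \sum_(a < n.+1) (q (i - Posz a) + phi (q (i - Posz a)) (q i) +
                   phi (q i) (q (i - Posz a))).

Let Ga_ge0 i a : 0 <= q (i - a) + phi (q (i - a)) (q i) + phi (q i) (q (i - a)).
Proof.
have := p0 (i - a) (- a); rewrite opprK subrK => h1.
by have := p0 i a; have := q0 (i - a); lra.
Qed.

Let G_ge0 i : 0 <= G i.
Proof.
by rewrite addr_ge0 ?sumr_ge0// mulr_ge0 ?addr_ge0// ltW.
Qed.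

Let isum_G : (\isum_i ((G i)%:E) < +oo)%E.
Proof.
have e1 i : (0 <= (q i * (cb i + 1))%:E)%E.
  by rewrite lee_fin mulr_ge0 ?addr_ge0// ltW.
under eq_esum do rewrite EFinD -sumEFin.
rewrite esumD//; last by move=> i _; rewrite sume_ge0// => a _; rewrite lee_fin.
rewrite esum_sum; last by move=> i a _ _; rewrite lee_fin.
apply: lte_add_pinfty.
  under eq_esum do rewrite mulrDr mulr1 EFinD.
  rewrite esumD; last 2 first.
  - by move=> i _; rewrite lee_fin mulr_ge0// ltW.
  - by move=> i _; rewrite lee_fin ltW.
  rewrite (grid_sum1 hq) lte_add_pinfty ?ltry//.
  by apply: le_lt_trans (grid_cost hq) _; rewrite ltry.
apply: lte_sum_pinfty => a _.
have e2 i : (0 <= (phi (q (i - Posz a)) (q i))%:E)%E.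
  by have := p0 (i - Posz a) (- Posz a); rewrite opprK subrK lee_fin.
have e3 i : (0 <= (phi (q i) (q (i - Posz a)))%:E)%E by rewrite lee_fin.
have e4 i : (0 <= (q (i - Posz a))%:E)%E by rewrite lee_fin ltW.
under eq_esum do rewrite EFinD (EFinD (q _)).
rewrite esumD; last 2 first.
- by move=> i _; apply: adde_ge0.
- by [].
rewrite esumD// (isum_shift (fun i => (q i)%:E)) (grid_sum1 hq).
have an : (`|Posz a| <= n)%N by rewrite /= -ltnS.
rewrite !lte_add_pinfty ?ltry//.
  rewrite -(isum_shift _ (Posz a)).
  under eq_esum do rewrite addrK -[X in phi _ (q (_ + X))]opprK.
  apply: le_lt_trans (grid_divergence hq (k := - Posz a) _) _.
    by rewrite abszN.
  by rewrite ltry.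
by apply: le_lt_trans (grid_divergence hq an) _; rewrite ltry.
Qed.

Let tail_small (e : R) (N0 : nat) : 0 < e -> exists N, [/\ (N0 <= N)%N,
  G (Posz N) <= e,
  (\sum_(N <= k <oo) (q (Posz k))%:E <= e%:E)%E &
  (\sum_(N <= k <oo) (q (Negz k))%:E <= e%:E)%E].
Proof.
move=> e0.
have qle i : q i <= G i.
  apply: le_trans (_ : q i * (cb i + 1) <= _).
    by rewrite ler_peMr ?lerDr// ltW.
  by rewrite lerDl sumr_ge0.
have Ge0 i : (0 <= (G i)%:E)%E by rewrite lee_fin.
have := isum_G; rewrite isum_split// => Gfin.
have Gp : (\sum_(0 <= k <oo) (G (Posz k))%:E < +oo)%E.
  by apply: le_lt_trans Gfin; rewrite leeDl// nneseries_ge0.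
have Gn : (\sum_(0 <= k <oo) (G (Negz k))%:E < +oo)%E.
  by apply: le_lt_trans Gfin; rewrite leeDr// nneseries_ge0.
have tp := nneseries_tail_cvg Gp (fun k _ => Ge0 _).
have tn := nneseries_tail_cvg Gn (fun k _ => Ge0 _).
have lee u : u @ \oo --> 0%E -> \forall N \near \oo, (u N <= e%:E)%E.
  move=> /fine_cvgP[fu /cvgrPdist_le /(_ e e0)]; move: fu.
  apply: filterS2 => N /fineK <-; rewrite sub0r normrN lee_fin.
  by apply: le_trans; exact: ler_norm.
near \oo => N; exists N; split.
- by near: N; exists N0.
- rewrite -lee_fin; apply: (@le_trans _ _ (\sum_(N <= k <oo) (G (Posz k))%:E)%E).
    by rewrite (nneseries_split N 1)// addn1 big_nat1 leeDl// nneseries_ge0.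
  by near: N; exact: lee.
- apply: (@le_trans _ _ (\sum_(N <= k <oo) (G (Posz k))%:E)%E).
    by apply: lee_nneseries => k *; rewrite lee_fin// ltW.
  by near: N; exact: lee.
- apply: (@le_trans _ _ (\sum_(N <= k <oo) (G (Negz k))%:E)%E).
    by apply: lee_nneseries => k *; rewrite lee_fin// ltW.
  by near: N; exact: lee.
Unshelve. all: by end_near. Qed.

Let qh N i : R := truncation N (fun m => q (Posz m)) `|i|%N.

Let qh0 N i : 0 < qh N i. Proof. exact: truncation_gt0. Qed.

Let qabs i : q i = q `|i|%N. Proof. exact: abs_even. Qed.

Let half01 : 0 < (2^-1 : R) <= 1.
Proof. by rewrite invr_gt0 ltr0n/= invf_le1// ler1n. Qed.

(** The growth 3/2 of the cost against the decay 1/2 of the tail, per cell. *)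
Let threequarters01 : 0 < ((1 + 2^-1) * 2^-1 : R) <= 1.
Proof. by apply/andP; split; lra. Qed.

Section fixed_N.
Variables (N : nat) (e : R).
Hypotheses (nN : (n < N)%N) (Ge : G (Posz N) <= e).
Hypotheses (tp : (\sum_(N <= k <oo) (q (Posz k))%:E <= e%:E)%E)
  (tn : (\sum_(N <= k <oo) (q (Negz k))%:E <= e%:E)%E).

(** The truncation agrees with [q] up to the cut, so only the mass of the two tails can be lost. *)
Let mass_ge : (1 <= \isum_i ((qh N i)%:E) + (2 * e)%:E)%E.
Proof.
have qe0 i : (0 <= (q i)%:E)%E by rewrite lee_fin ltW.
have qhe0 i : (0 <= (qh N i)%:E)%E by rewrite lee_fin ltW.
have cmp (f g : nat -> \bar R) (t : \bar R) : (forall k, 0 <= f k)%E ->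
    (forall k, 0 <= g k)%E -> (forall k, (k < N)%N -> f k = g k) ->
    (\sum_(N <= k <oo) f k <= t)%E ->
    (\sum_(k <oo) f k <= \sum_(k <oo) g k + t)%E.
  move=> f0 g0 fg ft; rewrite (nneseries_split 0 N)// add0n leeD//.
  rewrite (_ : (\sum_(0 <= k < N) f k = \sum_(0 <= k < N) g k)%E).
    exact: nneseries_lim_ge.
  by rewrite big_nat [RHS]big_nat; apply: eq_bigr => k /andP[_ kN]; exact: fg.
rewrite -(grid_sum1 hq) !isum_split//.
have -> : ((2 * e)%:E = e%:E + e%:E)%E by rewrite -EFinD; congr _%:E; ring.
rewrite addeACA; apply: leeD; apply: cmp => // k kN.
  by rewrite /qh truncation_le//= ltnW.
by rewrite /qh truncation_le// -qabs.
Qed.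

Let g_hyp a : (a <= n)%N ->
  [/\ q (Posz (N - a)) <= e, phi (q (Posz (N - a))) (q (Posz N)) <= e &
      phi (q (Posz N)) (q (Posz (N - a))) <= e].
Proof.
move=> an.
have aN : (a <= N)%N by exact: leq_trans an (ltnW nN).
have E : Posz N - Posz a = Posz (N - a) by exact: subzn.
have H : q (Posz (N - a)) + phi (q (Posz (N - a))) (q (Posz N)) +
    phi (q (Posz N)) (q (Posz (N - a))) <= e.
  apply: le_trans Ge; rewrite -E /G.
  rewrite (bigD1 (Ordinal (n:=n.+1) (m:=a) an))//= [leRHS]addrCA lerDl addr_ge0//.
    by rewrite mulr_ge0 ?addr_ge0// ltW.
  by rewrite sumr_ge0.
have h1 := p0 (Posz N) (Posz a).
have h2 := p0 (Posz N - Posz a) (- Posz a).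
rewrite opprK subrK in h2; rewrite E in h1 h2.
have h3 := q0 (Posz (N - a)).
by split; lra.
Qed.

Let q_le_e : q (Posz N) * (cb (Posz N) + 1) <= e.
Proof. by apply: le_trans Ge; rewrite lerDl sumr_ge0. Qed.

Let e_gt0 : 0 < e.
Proof.
apply: lt_le_trans q_le_e; rewrite mulr_gt0//.
by have := cb0 (Posz N); lra.
Qed.

Let mass_le : (\isum_i ((qh N i)%:E) <= (1 + 6 * e)%:E)%E.
Proof.
have qe0 i : (0 <= (q i)%:E)%E by rewrite lee_fin ltW.
have s01 : 0 <= (2^-1 : R) < 1 by apply/andP; split; lra.
apply: (@le_trans _ _ (\isum_i ((q i)%:E + (e)%:E * (peak 2^-1 N i)%:E))).
  apply: le_esum => i _; rewrite -EFinM -EFinD lee_fin.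
  have [iN|Ni] := leqP `|i|%N N.
    rewrite /qh truncation_le// -qabs lerDl mulr_ge0 ?(ltW e_gt0)//.
    by apply: peak_ge0; lra.
  rewrite /qh truncation_ge ?(ltnW Ni)//.
  apply: ler_wpDl; first exact: ltW.
  apply: ler_pM; rewrite ?(ltW (q0 _))// ?exprn_ge0 ?invr_ge0//.
    by have [] := g_hyp (leq0n n); rewrite subn0.
  by apply: peak_ge => //; exact: ltnW.
rewrite esumD//; last first.
  move=> i _; rewrite -EFinM lee_fin mulr_ge0 ?(ltW e_gt0)//.
  by apply: peak_ge0; lra.
rewrite isumZ ?(ltW e_gt0)//; last first.
  by move=> i; rewrite lee_fin; apply: peak_ge0; lra.
rewrite isum_peak// (grid_sum1 hq) -EFinM -EFinD lee_fin.
have -> : 2 * ((1 + 2^-1) / (1 - 2^-1)) = 6 :> R by field.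
lra.
Qed.

Let cb_growth m : cb (Posz (N + m)) + 1 <= (1 + 2^-1) ^+ m * (cb (Posz N) + 1).
Proof.
elim: m => [|m IH]; first by rewrite addn0 expr0 mul1r.
rewrite addnS exprS -mulrA; apply: (le_trans (cbS _)).
by rewrite ler_pM2l//; lra.
Qed.

Let cost_le : (\isum_i ((qh N i * cb i)%:E) <= (B + 14 * e)%:E)%E.
Proof.
have qe0 i : (0 <= (q i * cb i)%:E)%E by rewrite lee_fin mulr_ge0// ltW.
have s01 : 0 <= ((1 + 2^-1) * 2^-1 : R) < 1 by apply/andP; split; lra.
have s0 : 0 <= ((1 + 2^-1) * 2^-1 : R) by lra.
apply: (@le_trans _ _ (\isum_i ((q i * cb i)%:E +
    e%:E * (peak ((1 + 2^-1) * 2^-1) N i)%:E))).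
  apply: le_esum => i _; rewrite -EFinM -EFinD lee_fin.
  have [iN|Ni] := leqP `|i|%N N.
    rewrite /qh truncation_le// -qabs lerDl mulr_ge0 ?(ltW e_gt0)//.
    exact: peak_ge0.
  rewrite /qh truncation_ge ?(ltnW Ni)//.
  apply: ler_wpDl; first by rewrite mulr_ge0// ltW.
  rewrite (abs_even i cbN).
  have iE : `|i|%N = (N + (`|i| - N))%N by rewrite subnKC// ltnW.
  have h : cb `|i|%N <= (1 + 2^-1) ^+ (`|i| - N) * (cb (Posz N) + 1).
    by have := cb_growth (`|i| - N); rewrite -iE; lra.
  apply: le_trans (_ : q N * 2^-1 ^+ (`|i| - N) *
      ((1 + 2^-1) ^+ (`|i| - N) * (cb (Posz N) + 1)) <= _).
    by rewrite ler_wpM2l// mulr_ge0 ?(ltW (q0 _))// exprn_ge0// invr_ge0.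
  rewrite (_ : _ * _ = (q N * (cb N + 1)) *
      ((1 + 2^-1) * 2^-1) ^+ (`|i| - N)); last by rewrite exprMn; ring.
  apply: ler_pM => //; rewrite ?exprn_ge0//.
    by rewrite mulr_ge0 ?(ltW (q0 _))// addr_ge0.
  by apply: peak_ge => //; exact: ltnW.
rewrite esumD//; last first.
  move=> i _; rewrite -EFinM lee_fin mulr_ge0 ?(ltW e_gt0)//.
  exact: peak_ge0.
rewrite isumZ ?(ltW e_gt0)//; last first.
  by move=> i; rewrite lee_fin; exact: peak_ge0.
rewrite isum_peak// EFinD; apply: leeD; first exact: grid_cost hq.
rewrite -EFinM lee_fin.
have -> : 2 * ((1 + (1 + 2^-1) * 2^-1) / (1 - (1 + 2^-1) * 2^-1)) = 14 :> R.
  by field.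
lra.
Qed.

Let M : R := (n%:R + 1 + 2 ^+ n) * 2 ^+ n * 6.

Let div_le k : (`|k| <= n)%N ->
  (\isum_i ((phi (qh N i) (qh N (i - k)))%:E) <= (K + M * e)%:E)%E.
Proof.
move=> kn.
have s01 : 0 <= (2^-1 : R) < 1 by apply/andP; split; lra.
pose L : R := (n%:R + 1 + 2 ^+ n) * e * 2 ^+ n.
have c0' : 0 <= n%:R + 1 + 2 ^+ n :> R by rewrite !addr_ge0// exprn_ge0.
have L0 : 0 <= L by rewrite !mulr_ge0 ?exprn_ge0 ?(ltW e_gt0).
apply: (@le_trans _ _ (\isum_i ((phi (q i) (q (i - k)))%:E +
    L%:E * (peak 2^-1 N i)%:E))).
  apply: le_esum => i _; rewrite -EFinM -EFinD lee_fin.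
  apply: (le_trans (phi_truncation (n := n) (g := e) (x := `|i|%N)
    (y := `|i - k|%N) _ g_hyp _ _)) => //.
  - by clear -kn; lia.
  - by clear -kn; lia.
  rewrite -!qabs lerD2l.
  have pk0 : 0 <= peak 2^-1 N i by apply: peak_ge0; lra.
  case: ifPn => [_|]; first by rewrite mulr_ge0.
  rewrite -leqNgt => Nin.
  rewrite /L -[leRHS]mulrA; apply: ler_wpM2l.
    by rewrite mulr_ge0 ?(ltW e_gt0).
  have p2 : 1 <= 2 ^+ n :> R by rewrite exprn_ege1// ler1n.
  have [iN|Ni] := leqP `|i|%N N.
    have -> : (`|i| - N = 0)%N by apply/eqP; rewrite subn_eq0.
    rewrite expr0; have := peak_near half01 Nin iN => h.
    apply: le_trans (_ : 2 ^+ n * 2^-1 ^+ n <= _).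
      by rewrite -exprMn divff// expr1n.
    by rewrite ler_pM2l// exprn_gt0.
  apply: le_trans (peak_ge half01 (ltnW Ni)) _.
  by rewrite ler_peMl.
have pe0 i : (0 <= (phi (q i) (q (i - k)))%:E)%E by rewrite lee_fin.
have pk0 i : (0 <= (peak 2^-1 N i)%:E)%E.
  by rewrite lee_fin; apply: peak_ge0; lra.
rewrite esumD//; last by move=> i _; rewrite mule_ge0// lee_fin.
rewrite isumZ// isum_peak// EFinD; apply: leeD.
  exact: (grid_divergence hq kn).
rewrite -EFinM lee_fin.
have -> : 2 * ((1 + 2^-1) / (1 - 2^-1)) = 6 :> R by field.
by rewrite /L /M; lra.
Qed.

(** The truncation is normalised by its mass [Z >= 1 - 2 * e]; the hypotheses say that [B + 14 * e]
    and [K + M * e] are at most [1 - 2 * e] times the final bounds. The constant 14 is the sum of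
    two two-sided geometric series of ratio 3/4, and the 6 in [M] that for ratio 1/2. *)
Lemma grid_truncation_fixed (eps : R) : 0 < eps -> 2 * e <= 2^-1 ->
  14 * e + 2 * e * (B + eps) <= eps -> M * e + 2 * e * (K + eps) <= eps ->
  exists p : nat -> R, grid_mechanism n cb (B + eps) (K + eps)
    (fun i => truncation N p `|i|%N).
Proof.
move=> eps0 e2 eB eK.
pose Z := fine (\isum_i ((qh N i)%:E)).
have qhe0 i : (0 <= (qh N i)%:E)%E by rewrite lee_fin ltW.
have ZE : (\isum_i ((qh N i)%:E) = Z%:E)%E.
  rewrite fineK// ge0_fin_numE; last exact: esum_ge0.
  by apply: le_lt_trans mass_le _; rewrite ltry.
have Z1 : 1 - 2 * e <= Z.
  by have := mass_ge; rewrite ZE -EFinD lee_fin; lra.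
have Z0 : 0 < Z by lra.
have ZV0 : 0 <= Z^-1 by rewrite invr_ge0 ltW.
exists (fun m => Z^-1 * q (Posz m)).
have qhE i : truncation N (fun m => Z^-1 * q (Posz m)) `|i|%N = Z^-1 * qh N i.
  by rewrite /qh /truncation; case: ifP => // _; rewrite mulrA.
split.
- by move=> i; rewrite qhE mulr_gt0// invr_gt0.
- under eq_esum do rewrite qhE EFinM.
  by rewrite isumZ// ZE -EFinM mulVf// gt_eqF.
- under eq_esum do rewrite qhE -mulrA EFinM.
  rewrite isumZ//; last by move=> i; rewrite lee_fin mulr_ge0// ltW.
  apply: (@le_trans _ _ ((Z^-1)%:E * (B + 14 * e)%:E)%E).
    by apply: lee_wpmul2l; rewrite ?lee_fin.
  rewrite -EFinM lee_fin mulrC ler_pdivrMr//.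
  apply: le_trans (_ : (B + eps) * (1 - 2 * e) <= _); first by lra.
  by rewrite ler_wpM2l// addr_ge0// ltW.
- move=> k kn; rewrite /grid_div.
  under eq_esum do rewrite !qhE (phiZ ZV0 (ltW (qh0 _ _)) (qh0 _ _)) EFinM.
  rewrite isumZ//; last first.
    move=> i; rewrite lee_fin; apply: phi_ge0; rewrite ?(ltW (qh0 _ _))//.
    by move=> /eqP; rewrite gt_eqF.
  apply: (@le_trans _ _ ((Z^-1)%:E * (K + M * e)%:E)%E).
    by apply: lee_wpmul2l; [rewrite lee_fin|exact: div_le].
  rewrite -EFinM lee_fin mulrC ler_pdivrMr//.
  apply: le_trans (_ : (K + eps) * (1 - 2 * e) <= _); first by lra.
  by rewrite ler_wpM2l// addr_ge0// ltW.
Qed.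

End fixed_N.

Lemma grid_truncation (eps : R) : 0 < eps ->
  exists N (p : nat -> R), (0 < N)%N /\
    grid_mechanism n cb (B + eps) (K + eps) (fun i => truncation N p `|i|%N).
Proof.
move=> eps0.
pose M : R := (n%:R + 1 + 2 ^+ n) * 2 ^+ n * 6.
have M0 : 0 <= M by rewrite !mulr_ge0 ?addr_ge0 ?exprn_ge0.
(* [A] adds up the coefficients of [e] in all the smallness conditions, with 18 covering both
   [14 * e] and [4 * e <= 1]. *)
pose A : R := 18 + M + 2 * (B + eps) + 2 * (K + eps).
have A0 : 18 <= A by rewrite /A; have := B0; have := K0; lra.
pose e : R := Num.min 1 eps / A.
have [m0 m1 m2] : [/\ 0 < Num.min 1 eps, Num.min 1 eps <= 1 & Num.min 1 eps <= eps].
  by rewrite lt_min ltr01 eps0 !ge_min !lexx orbT.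
have e0 : 0 < e by rewrite divr_gt0//; lra.
have Ae : A * e <= eps by rewrite /e mulrC divfK ?gt_eqF//; lra.
have Ae1 : A * e <= 1 by rewrite /e mulrC divfK ?gt_eqF//; lra.
have [N [nN Ge tp tn]] := tail_small n.+1 e0.
have Be : 0 <= (B + eps) * e by rewrite mulr_ge0 ?addr_ge0 ?(ltW e0) ?(ltW eps0).
have Ke : 0 <= (K + eps) * e by rewrite mulr_ge0 ?addr_ge0 ?(ltW e0) ?(ltW eps0).
have Me : 0 <= M * e by rewrite mulr_ge0 ?(ltW e0).
rewrite /A in Ae Ae1.
have [||||p hp] := @grid_truncation_fixed N e nN Ge tp tn eps => //; try lra.
- by rewrite -/M; lra.
by exists N, p; split => //; exact: leq_ltn_trans nN.
Qed.

End grid_truncation.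

(** * Translates of a density *)

(* [lebesgue_measure] lives on [measurableTypeR R], whose display differs from
   the one of the canonical measurable structure on [R] used by
   [probability R R]; [lebR] is the same set function on the latter. *)
Definition lebR (R : realType) : set R -> \bar R := @lebesgue_measure R.

Section lebR.
Variable R : realType.
Local Notation leb := (@lebesgue_measure R).

Let lebR0 : @lebR R set0 = 0%E. Proof. exact: (measure0 leb). Qed.

Let lebR_ge0 (A : set R) : (0 <= lebR A)%E. Proof. exact: (measure_ge0 leb). Qed.

Let lebR_sigma_additive : semi_sigma_additive (@lebR R).
Proof. exact: (@measure_semi_sigma_additive _ _ _ leb). Qed.

HB.instance Definition _ := isMeasure.Build _ _ _ (@lebR R)
  lebR0 lebR_ge0 lebR_sigma_additive.

Let lebR_sigma_finite : sigma_finite setT (@lebR R).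
Proof. exact: (sigma_finiteT leb). Qed.

HB.instance Definition _ :=
  @Measure_isSigmaFinite.Build _ _ _ (@lebR R) lebR_sigma_finite.

Lemma ge0_integral_lebR (D : set R) (f : R -> \bar R) : measurable D ->
  measurable_fun D f -> (forall x, D x -> 0 <= f x)%E ->
  (\int[@lebR R]_(x in D) f x = \int[leb]_(x in D) f x)%E.
Proof.
move=> mD mf f0.
have mid : measurable_fun [set: measurableTypeR R] (idfun : measurableTypeR R -> R).
  by move=> _ B mB; rewrite setTI.
have H := @ge0_integral_pushforward _ _ (measurableTypeR R) R R
  (idfun : measurableTypeR R -> R) mid leb D f mD mf.
rewrite -[RHS]H; last by move=> x /[!inE]; exact: f0.
by apply: eq_measure_integral => //; exact: mid.
Qed.

End lebR.

Section lebesgue_translation.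
Variable R : realType.
Local Notation leb := (@lebesgue_measure R).

Definition shifted_lebesgue (a : R) : set (measurableTypeR R) -> \bar R :=
  fun A => leb (translation a @^-1` A).

Let shifted_lebesgue0 a : shifted_lebesgue a set0 = 0%E.
Proof. by rewrite /shifted_lebesgue preimage_set0 measure0. Qed.

Let shifted_lebesgue_ge0 a A : (0 <= shifted_lebesgue a A)%E.
Proof. exact: measure_ge0. Qed.

Let shifted_lebesgue_sigma a : semi_sigma_additive (shifted_lebesgue a).
Proof.
move=> F mF tF mUF; rewrite /shifted_lebesgue preimage_bigcup.
apply: measure_semi_sigma_additive.
- by move=> i; apply: measurable_translation_preimage; exact: mF.
- apply/trivIsetP => /= i j _ _ ij; rewrite -preimage_setI.
  by move/trivIsetP : tF => /(_ _ _ _ _ ij) ->//; rewrite preimage_set0.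
- by rewrite -preimage_bigcup; exact: measurable_translation_preimage.
Qed.

HB.instance Definition _ a := isMeasure.Build _ _ _ (shifted_lebesgue a)
  (shifted_lebesgue0 a) (@shifted_lebesgue_ge0 a) (@shifted_lebesgue_sigma a).

Lemma lebesgue_measure_translation (a : R) (A : set R) : measurable A ->
  lebR (translation a @^-1` A) = lebR A.
Proof.
move=> mA; apply/esym.
apply: (@lebesgue_measure_unique R (shifted_lebesgue a) _ A mA).
move=> _ [[x y] _ <-]; rewrite /= /shifted_lebesgue.
have -> : translation a @^-1` `]x, y] = `]x - a, y - a]%classic.
  apply/seteqP; split => z /=; rewrite /translation !in_itv/=.
    by move=> /andP[? ?]; apply/andP; split; lra.
  by move=> /andP[? ?]; apply/andP; split; lra.
rewrite !lebesgue_measure_itv/= !lte_fin ltrD2r -!EFinB.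
by case: ifP => // _; congr _%:E; ring.
Qed.

Lemma ge0_integral_translation (a : R) (B : set R) (f : R -> \bar R) :
  measurable B -> measurable_fun [set: R] f -> (forall x, 0 <= f x)%E ->
  (\int[@lebR R]_(x in translation a @^-1` B) f (translation a x) =
   \int[@lebR R]_(x in B) f x)%E.
Proof.
move=> mB mf f0.
rewrite -(ge0_integral_pushforward (measurable_translation a))//; last first.
  exact: measurable_funTS.
by apply: eq_measure_integral => A mA _; exact: lebesgue_measure_translation.
Qed.

End lebesgue_translation.

Section density_probability.
Variables (R : realType) (f : R -> R).
Hypotheses (mf : measurable_fun [set: R] f) (f0 : forall x, 0 <= f x).
Hypothesis f1 : (\int[@lebR R]_x (f x)%:E = 1)%E.

(** The proofs are arguments so that the measure and probability instances can be recovered from the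
    term. *)
Definition density_measure (_ : measurable_fun [set: R] f)
    (_ : forall x, 0 <= f x)
    (_ : (\int[@lebR R]_x (f x)%:E = 1)%E) (A : set R) : \bar R :=
  (\int[@lebR R]_(x in A) (f x)%:E)%E.

Local Notation mu := (density_measure mf f0 f1).

Let mu0 : mu set0 = 0%E. Proof. exact: integral_set0. Qed.

Let mu_ge0 A : (0 <= mu A)%E.
Proof. by apply: integral_ge0 => x _; rewrite lee_fin. Qed.

Let mu_sigma : semi_sigma_additive mu.
Proof.
apply: (@semi_sigma_additive_nng_induced _ R R
  (@lebR R) (EFin \o f)); first exact/measurable_EFinP.
by move=> x; rewrite lee_fin.
Qed.

HB.instance Definition _ := isMeasure.Build _ _ _ mu mu0 mu_ge0 mu_sigma.

HB.instance Definition _ := Measure_isProbability.Build _ _ _ mu f1.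

Lemma density_probability : exists P : probability R R,
  forall B, P B = (\int[@lebR R]_(x in B) (f x)%:E)%E.
Proof. by exists mu. Qed.

End density_probability.

(* The change of variables [y = x + a] makes the divergence of a density from
   its translate an integral over [x] in which [f] itself is the reference. *)
Lemma KL_translate_density (R : realType) (P : probability R R) (f : R -> R)
    (a : R) : measurable_fun [set: R] f -> (forall x, 0 < f x) ->
  (forall B, measurable B ->
    P B = (\int[@lebR R]_(x in B) (f x)%:E)%E) ->
  (KL P (translate a P) =
   \int[@lebR R]_x (phi (f (x + a)) (f x))%:E)%E.
Proof.
move=> mf f0 hP.
have tK x : translation (- a) (translation a x) = x by rewrite /translation addrK.
have mta := @measurable_translation R a.
have mtN := @measurable_translation R (- a).
have mfV : measurable_fun setT (fun x => (f x)^-1).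
  have -> : (fun x => (f x)^-1) = (fun x => expR (- ln (f x))).
    by apply/funext => x; rewrite expRN lnK ?posrE.
  apply: measurableT_comp => //; apply: measurableT_comp => //.
  exact: measurableT_comp.
pose h y : R := f y / f (translation (- a) y).
have mh : measurable_fun setT h.
  apply: measurable_funM => //.
  exact: (@measurableT_comp _ _ _ _ _ _ (fun x => (f x)^-1)).
have h0 y : 0 < h y by rewrite divr_gt0.
have mht : measurable_fun setT (h \o translation a) by exact: measurableT_comp.
have hE x : h (translation a x) = f (x + a) / f x by rewrite /h tK.
have dens := @ge0_integral_density _ R R P (@lebR R) f mf hP.
have TE (u : R -> \bar R) (D : set R) : measurable D -> measurable_fun setT u ->
    (forall x, 0 <= u x)%E ->
    (\int[translate a P]_(y in D) u y =
     \int[P]_(x in translation a @^-1` D) u (translation a x))%E.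
  move=> mD mu u0; rewrite -(ge0_integral_pushforward mta)//.
  exact: measurable_funTS.
rewrite (@KL_density _ _ _ P (translate a P) h)//; first last.
- move=> B mB; rewrite TE//; last 2 first.
  + exact/measurable_EFinP.
  + by move=> x; rewrite lee_fin ltW.
  rewrite dens//; last 3 first.
  + exact: measurable_translation_preimage.
  + by apply/measurable_EFinP.
  + by move=> x; rewrite lee_fin ltW.
  rewrite hP// -(ge0_integral_translation a mB); last 2 first.
  + exact/measurable_EFinP.
  + by move=> x; rewrite lee_fin ltW.
  by apply: eq_integral => x _; rewrite -EFinM hE divfK// gt_eqF.
- by move=> x; exact: ltW.
have mp : measurable_fun setT (fun y => (phi (h y) 1)%:E).
  by apply/measurable_EFinP; exact: measurable_phi.
have p0 y : (0 <= (phi (h y) 1)%:E)%E.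
  by rewrite lee_fin phi_ge0 ?(ltW (h0 y))// => /eqP; rewrite oner_eq0.
rewrite TE// preimage_setT dens//.
  apply: eq_integral => x _; rewrite -EFinM hE; congr _%:E.
  rewrite mulrC -phiZ ?(ltW (f0 x))//; last by rewrite divr_ge0 ?ltW.
  by rewrite mulr1 mulrC divfK// gt_eqF.
by apply/measurable_EFinP; exact: measurable_phi.
Qed.

(** * From grid laws to cactus laws *)

Section cells.
Variables (R : realType) (n : nat).
Hypothesis n0 : (0 < n)%N.

Let n0R : 0 < n%:R :> R. Proof. by rewrite ltr0n. Qed.

Lemma cell_indexP (x : R) i : cell_index n x = i <-> cell n i x.
Proof.
have [j [cj uj]] := cell_partition x n0.
have e : cell_index n x = j.
  have : [set i | cell n i x] (cell_index n x) by apply: xgetPex; exists j.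
  by move/uj.
by rewrite e; split => [<-//|/uj].
Qed.

Lemma cell_index_near (x : R) (i : int) :
  i%:~R - 2^-1 < n%:R * x < i%:~R + 2^-1 -> cell_index n x = i.
Proof.
move=> /andP[h1 h2]; apply/cell_indexP/(cellP _ _ n0); split=> //.
by apply/andP; split; exact: ltW.
Qed.

Lemma measurable_cell i : measurable (cell n i : set R).
Proof. by rewrite /cell; case: ifP => // _; case: ifP. Qed.

Lemma lebR_cell i : lebR (cell n i : set R) = (n%:R^-1)%:E.
Proof.
have e : (i%:~R + 2^-1) / n%:R - (i%:~R - 2^-1) / n%:R = n%:R^-1 :> R.
  by field; rewrite gt_eqF.
have lt : (i%:~R - 2^-1) / n%:R < (i%:~R + 2^-1) / n%:R :> R.
  by rewrite ltr_pM2r ?invr_gt0//; lra.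
rewrite /cell /lebR; case: ifP => [/eqP i0|_].
  rewrite i0 /= in e lt; rewrite lebesgue_measure_itv/= lte_fin.
  rewrite invfM -mulNr -EFinB; move: e lt; rewrite !sub0r !add0r => -> ->.
  by [].
by case: ifP => _; rewrite lebesgue_measure_itv/= lte_fin lt -EFinB e.
Qed.

Lemma trivIset_cell : trivIset [set: int] (fun i => cell n i : set R).
Proof.
by move=> i j _ _ [x [/cell_indexP <- /cell_indexP <-]].
Qed.

Lemma bigcup_cell : \bigcup_i (cell n i : set R) = [set: R].
Proof.
by apply/seteqP; split => // x _; exists (cell_index n x) => //; apply/cell_indexP.
Qed.

Lemma measurable_fun_cell_index (u : int -> R) :
  measurable_fun [set: R] (fun x => u (cell_index n x)).
Proof.
move=> _ B mB; rewrite setTI.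
have -> : (fun x : R => u (cell_index n x)) @^-1` B =
    \bigcup_i (if `[< B (u i) >] then cell n i else set0).
  apply/seteqP; split => x /=.
    move=> Bx; exists (cell_index n x) => //; rewrite asboolT//.
    exact/cell_indexP.
  by move=> [i _]; case: asboolP => // Bi /cell_indexP ->.
apply: countable_bigcupT_measurable; first exact: countableP.
by move=> i; case: ifP => // _; exact: measurable_cell.
Qed.

End cells.

Section cactus_of_grid.
Variables (R : realType) (c : R -> R) (n N : nat) (p : nat -> R) (B K : R).
Hypotheses (hc : cost_function c) (n0 : (0 < n)%N) (N0 : (0 < N)%N).

Let q (i : int) : R := truncation N p `|i|%N.

Hypothesis hq : grid_mechanism n (cell_cost c n) B K q.

Let q0 i : 0 < q i. Proof. exact: grid_gt0 hq i. Qed.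

Let qe0 i : (0 <= (q i)%:E)%E. Proof. by rewrite lee_fin ltW. Qed.

Let n0R : 0 < n%:R :> R. Proof. by rewrite ltr0n. Qed.

Let pf (i : 'I_N.+1) : R := p i.

Let f : R -> R := cactus_density n 2^-1 pf.

Let fE x : f x = n%:R * q (cell_index n x).
Proof.
rewrite /f /cactus_density /q /truncation /pf.
case: ifP => iN; first by rewrite inordK// ltnW.
by rewrite mulrA.
Qed.

Let f0 x : 0 < f x. Proof. by rewrite fE mulr_gt0. Qed.

Let mf : measurable_fun [set: R] f.
Proof.
rewrite (_ : f = fun x => n%:R * q (cell_index n x)); last exact/funext.
exact: (measurable_fun_cell_index n0 (fun i => n%:R * q i)).
Qed.

Let mE := @measurable_cell R n.

Let integral_cell i : (\int[@lebR R]_(x in cell n i) (f x)%:E = (q i)%:E)%E.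
Proof.
rewrite (eq_integral (cst (n%:R * q i)%:E)); last first.
  by move=> x; rewrite inE => /(cell_indexP n0) ci; rewrite fE ci.
rewrite integral_cst; last exact: mE.
rewrite [X in (_ * X)%E](lebR_cell R n0) -EFinM; congr _%:E.
by rewrite mulrAC divff ?mul1r// gt_eqF.
Qed.

Let f1 : (\int[@lebR R]_x (f x)%:E = 1)%E.
Proof.
rewrite (integral_partition_int _ mE)//; first last.
- by move=> x; rewrite lee_fin ltW.
- exact/measurable_EFinP.
- exact: bigcup_cell.
- exact: trivIset_cell.
under eq_esum do rewrite integral_cell.
exact: grid_sum1 hq.
Qed.

(** Used with [m = 0] for the nonnegative integers and [m = 1] for the negative ones, since [Negz k]
    is [- (k + 1)]. *)
Let truncation_sum m : (m <= N)%N ->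
  (\sum_(k <oo) (truncation N p (k + m))%:E =
   (\sum_(m <= k < N) p k + 2 * p N)%:E)%E.
Proof.
move=> mN.
have t0 k : (0 <= (truncation N p k)%:E)%E by exact: (qe0 (Posz k)).
rewrite (nneseries_addn m (f := fun k => (truncation N p k)%:E))//.
rewrite (nneseries_split m (N - m))// subnKC// EFinD; congr (_ + _)%E.
  rewrite sumEFin; congr _%:E; apply: eq_big_nat => k /andP[_ kN].
  by rewrite truncation_le// ltnW.
rewrite -(nneseries_addn N (f := fun k => (truncation N p k)%:E))//.
under eq_eseriesr => k _.
  rewrite truncation_ge ?leq_addl// addnK EFinM; over.
rewrite nneseriesZl; last by move=> k _; rewrite lee_fin exprn_ge0// invr_ge0.
rewrite nneseries_geometric; last by apply/andP; split; lra.
by rewrite -EFinM; congr _%:E; field.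
Qed.

Let cactus_mass1 : cactus_mass 2^-1 pf = 1.
Proof.
apply: EFin_inj; rewrite -(grid_sum1 hq) isum_split//.
have -> : (\sum_(k <oo) (q (Posz k))%:E =
    \sum_(k <oo) (truncation N p (k + 0))%:E)%E.
  by apply: eq_eseriesr => k _; rewrite addn0.
have -> : (\sum_(k <oo) (q (Negz k))%:E =
    \sum_(k <oo) (truncation N p (k + 1))%:E)%E.
  by apply: eq_eseriesr => k _; rewrite addn1.
rewrite !truncation_sum// -EFinD; congr _%:E.
rewrite /cactus_mass /pf (big_ltn N0)/=.
rewrite (eq_big_nat _ _ (F2 := fun i => 2 * p i)); last first.
  by move=> i /andP[_ iN]; rewrite inordK// ltnW.
by rewrite -big_distrr/=; field.
Qed.

Let pf01 i : 0 <= pf i <= 1.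
Proof.
have iN : (i <= N)%N by rewrite -ltnS.
have -> : pf i = q (Posz i) by rewrite /q truncation_le.
rewrite ltW//= -lee_fin -(grid_sum1 hq).
exact: (isum_ge_term (u := fun i => (q i)%:E)).
Qed.

Section divergence.
Variables (a : R) (i : int).
Let k : int := Num.floor (n%:R * a).
Let theta : R := n%:R * a - k%:~R.

Let theta01 : 0 <= theta < 1.
Proof.
have := floor_itv (n%:R * a); rewrite intrD -/k /theta => /andP[h1 h2].
by apply/andP; split; lra.
Qed.

Let g x : \bar R := (phi (f (x + a)) (f x))%:E.

Let mg : measurable_fun [set: R] g.
Proof.
apply/measurable_EFinP; apply: measurable_phi => //.
by apply: measurableT_comp => //; exact: measurable_translation.
Qed.

Let g0 x : (0 <= g x)%E.
Proof.
rewrite lee_fin; apply: phi_ge0; rewrite ?(ltW (f0 _))//.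
by move=> /eqP; rewrite gt_eqF.
Qed.

Let integral_subcell (b0 b1 : bool) (s t : R) (j : int) : s <= t ->
  (forall x : R, s / n%:R < x < t / n%:R ->
     cell_index n x = i /\ cell_index n (x + a) = j) ->
  (\int[@lebR R]_(x in
      [set` Interval (BSide b0 (s / n%:R)%R) (BSide b1 (t / n%:R)%R)])
     g x = ((t - s) * phi (q j) (q i))%:E)%E.
Proof.
move=> st hst.
rewrite ge0_integral_lebR//; last exact: measurable_funTS.
rewrite integral_itv_bndoo; last exact: measurable_funTS.
rewrite (eq_integral (cst (n%:R * phi (q j) (q i))%:E)); last first.
  move=> x; rewrite inE/= in_itv/= => /hst[e1 e2].
  rewrite /g !fE e1 e2 phiZ// ?(ltW n0R)//; exact: ltW.
rewrite integral_cst//= lebesgue_measure_itv/= lte_fin ltr_pM2r ?invr_gt0//.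
case: ltP => [_|ts].
  by rewrite -EFinB -EFinM; congr _%:E; field; rewrite gt_eqF.
have -> : t = s by apply/le_anti; rewrite ts st.
by rewrite subrr mul0r mule0.
Qed.

(** As [x] runs through cell [i], [x + a] lies in cell [i + k] on a proportion [1 - theta] of the
    cell and in cell [i + k + 1] on the rest. *)
Lemma integral_cell_divergence :
  (\int[@lebR R]_(x in cell n i) g x <=
   ((1 - theta) * phi (q (i + k)) (q i) +
    theta * phi (q (i + k + 1)) (q i))%:E)%E.
Proof.
have /andP[h0 h1] := theta01.
pose u : R := i%:~R - 2^-1; pose v : R := i%:~R + 2^-1.
pose w : R := i%:~R + 2^-1 - theta.
have mulx (x s t : R) : s / n%:R < x < t / n%:R -> s < n%:R * x < t.
  by rewrite ltr_pdivrMr// ltr_pdivlMr// mulrC.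
have na : n%:R * a = k%:~R + theta by rewrite /theta; ring.
(* Passing to the closed interval removes the dependence of the endpoints on the sign of [i]. *)
apply: (@le_trans _ _ (\int[@lebR R]_(x in `[(u / n%:R)%R, (v / n%:R)%R]) g x)%E).
  apply: ge0_subset_integral => //; first exact: measurable_funTS.
  move=> x /(cellP _ _ n0)[/andP[e1 e2] _ _] /=; rewrite in_itv/=.
  by rewrite ler_pdivrMr// ler_pdivlMr// mulrC e1 e2.
have uw : u / n%:R <= w / n%:R.
  by rewrite ler_pM2r ?invr_gt0// /u /w; lra.
have wv : w / n%:R <= v / n%:R.
  by rewrite ler_pM2r ?invr_gt0// /v /w; lra.
have -> : `[u / n%:R, v / n%:R]%classic =
    `[u / n%:R, w / n%:R[ `|` `[w / n%:R, v / n%:R].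
  by apply: itv_bndbnd_setU; rewrite bnd_simp.
rewrite ge0_integral_setU//; first last.
- rewrite disj_set2E; apply/eqP/seteqP; split => // x [] /=.
  by rewrite !in_itv/= => /andP[_ xw] /andP[wx _]; rewrite ltNge wx in xw.
- exact: measurable_funTS.
rewrite (@integral_subcell true true u w (i + k)); last 2 first.
- by rewrite /u /w; lra.
- move=> x /mulx /andP[e1 e2]; split; apply: cell_index_near => //.
    by rewrite /u /w in e1 e2; apply/andP; split; lra.
  rewrite mulrDr na intrD.
  by rewrite /u /w in e1 e2; apply/andP; split; lra.
rewrite (@integral_subcell true false w v (i + k + 1)); last 2 first.
- by rewrite /v /w; lra.
- move=> x /mulx /andP[e1 e2]; split; apply: cell_index_near => //.
    by rewrite /v /w in e1 e2; apply/andP; split; lra.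
  rewrite mulrDr na !intrD.
  by rewrite /v /w in e1 e2; apply/andP; split; lra.
rewrite -EFinD lee_fin le_eqVlt; apply/orP; left; apply/eqP.
by rewrite /u /v /w; field.
Qed.

End divergence.

Let phi_q0 i j : 0 <= phi (q i) (q j).
Proof. by apply: phi_ge0; rewrite ?(ltW (q0 _))// => /eqP; rewrite gt_eqF. Qed.

Let integral_divergence (a : R) : `|a| <= 1 ->
  (\int[@lebR R]_x (phi (f (x + a)) (f x))%:E <= K%:E)%E.
Proof.
move=> a1; pose k : int := Num.floor (n%:R * a).
pose theta : R := n%:R * a - k%:~R.
have /andP[e1 e2] : k%:~R <= n%:R * a < k%:~R + 1.
  by have := floor_itv (n%:R * a); rewrite intrD.
have [t0 t1] : 0 <= theta /\ 0 <= 1 - theta by rewrite /theta; split; lra.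
have [b1 b2] : - n%:R <= n%:R * a /\ n%:R * a <= n%:R.
  move: a1; rewrite ler_norml => /andP[? ?]; split.
    by rewrite -mulrN1 ler_pM2l.
  by rewrite -[leRHS]mulr1 ler_pM2l.
have [K1 K2] : (- Posz n <= k /\ k <= Posz n)%R.
  split.
    by rewrite -ltzD1 -(ltr_int R) intrD intrN; apply: le_lt_trans b1 e2.
  by rewrite -(ler_int R); apply: le_trans e1 b2.
have kn : (`|k| <= n)%N by clear -K1 K2; lia.
have divE m : (`|m| <= n)%N ->
    (\isum_i ((phi (q (i + m)) (q i))%:E) <= K%:E)%E.
  move=> mn; apply: le_trans (grid_divergence hq mn).
  rewrite /grid_div -(isum_shift (fun i => (phi (q i) (q (i - m)))%:E) m).
  by under [leRHS]eq_esum do rewrite addrK.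
rewrite (integral_partition_int _ mE)//; first last.
- move=> x; rewrite lee_fin; apply: phi_ge0; rewrite ?(ltW (f0 _))//.
  by move=> /eqP; rewrite gt_eqF.
- apply/measurable_EFinP; apply: measurable_phi => //.
  by apply: measurableT_comp => //; exact: measurable_translation.
- exact: bigcup_cell.
- exact: trivIset_cell.
have P1 i : (0 <= (phi (q (i + k)) (q i))%:E)%E by rewrite lee_fin.
have P2 i : (0 <= (phi (q (i + (k + 1))) (q i))%:E)%E by rewrite lee_fin.
apply: (@le_trans _ _ (\isum_i ((1 - theta)%:E * (phi (q (i + k)) (q i))%:E +
    theta%:E * (phi (q (i + (k + 1))) (q i))%:E))).
  apply: le_esum => i _; rewrite -!EFinM -EFinD addrA.
  exact: integral_cell_divergence.
rewrite esumD; [|by move=> i _; rewrite mule_ge0..].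
rewrite !isumZ//.
have -> : (K%:E = (1 - theta)%:E * K%:E + theta%:E * K%:E)%E.
  by rewrite -!EFinM -EFinD; congr _%:E; ring.
apply: leeD; first by apply: lee_wpmul2l; [rewrite lee_fin|exact: divE].
(* The shift [k + 1] leaves the range only for [k = n], that is [a = 1], and then its weight [theta]
   is 0. *)
have [kn1|kn1] := boolP (`|(k + 1)%R| <= n)%N.
  by apply: lee_wpmul2l; [rewrite lee_fin|exact: divE].
have kE : k = Posz n by move: kn1; clear -K1 K2; lia.
have -> : theta = 0.
  by apply/le_anti; rewrite t0 andbT /theta kE; move: b2; lra.
by rewrite !mul0e.
Qed.

Lemma cactus_of_grid : exists P : probability R R, [/\ cactus_class n N 2^-1 P,
  (\int[P]_x (c x)%:E <= B%:E)%E &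
  forall a, `|a| <= 1 -> (KL P (translate a P) <= K%:E)%E].
Proof.
have [P hP] := density_probability mf (fun x => ltW (f0 x)) f1.
exists P; split.
- exists pf; split => // A mA; rewrite hP /cactus_measure.
  rewrite ge0_integral_lebR//; first exact/measurable_funTS/measurable_EFinP.
  by move=> x _; rewrite lee_fin ltW.
- have mc : measurable_fun setT c.
    exact: continuous_measurable_fun (cost_continuous hc).
  rewrite (integral_partition_int _ mE)//; first last.
  + by move=> x; rewrite lee_fin; exact: cost_ge0.
  + exact/measurable_EFinP.
  + exact: bigcup_cell.
  + exact: trivIset_cell.
  apply: le_trans (grid_cost hq); apply: le_esum => i _.
  rewrite mulrC EFinM -integral_cell -hP -integral_cst; last exact: mE.
  apply: ge0_le_integral => //=.
  + by move=> x _; rewrite lee_fin; exact: cost_ge0.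
  + exact/measurable_funTS/measurable_EFinP.
  + move=> x /(cellP _ _ n0)[h _ _]; rewrite lee_fin.
    exact: cell_cost_ge.
- move=> a a1; rewrite (KL_translate_density a mf f0)//.
  exact: integral_divergence.
Qed.

End cactus_of_grid.

(** * Comparison of the two infima *)

Section translation_kernel.
Variables (R : realType) (P : probability R R).

Definition translation_kernel (x : R) : {measure set R -> \bar R} :=
  translate x P.

Let measurable_translation_kernel (U : set R) : measurable U ->
  measurable_fun [set: R] (translation_kernel ^~ U).
Proof.
(* [translation_kernel x U] is the [P]-measure of the section of this plane set at [x]. *)
move=> mU; pose A := [set z : R * R | U (z.2 + z.1)].
have mA : measurable A.
  rewrite (_ : A = (fun z : R * R => z.2 + z.1) @^-1` U)//.
  by rewrite -(setTI (_ @^-1` _)); apply: measurable_funD.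
rewrite (_ : translation_kernel ^~ U = P \o xsection A).
  exact: measurable_fun_xsection.
apply/funext => x /=; rewrite /translate /distribution /pushforward; congr (P _).
by apply/seteqP; split => y; rewrite /xsection /A /= inE.
Qed.

HB.instance Definition _ :=
  isKernel.Build _ _ R R R translation_kernel measurable_translation_kernel.

Let translation_kernel_prob x : translation_kernel x [set: R] = 1%E.
Proof. exact: (probability_setT (translate x P)). Qed.

HB.instance Definition _ := Kernel_isProbability.Build _ _ R R R
  translation_kernel translation_kernel_prob.

End translation_kernel.

Section translation_mechanism.
Variables (R : realType) (c : R -> R) (P : probability R R).
Hypothesis hc : cost_function c.

Lemma translate_cost x :
  (\int[translate x P]_y (c (y - x))%:E = \int[P]_y (c y)%:E)%E.
Proof.
have mc : measurable_fun setT c.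
  exact: continuous_measurable_fun (cost_continuous hc).
rewrite -[LHS]/(\int[distribution P (translation x)]_y (c (y - x))%:E)%E.
rewrite ge0_integral_distribution.
- by apply: eq_integral => y _ /=; rewrite /translation addrK.
- apply/measurable_EFinP; apply: measurableT_comp => //.
  exact: measurable_funB.
- by move=> y; rewrite lee_fin; exact: cost_ge0.
Qed.

Lemma KL_translation_mechanism (P1 P2 : probability R R) x x' :
  (forall B, measurable B -> P1 B = translate x P B) ->
  (forall B, measurable B -> P2 B = translate x' P B) ->
  KL P1 P2 = KL P (translate (x' - x) P).
Proof.
move=> h1 h2; apply: (KL_translate (a := x)) => B mB; first exact: h1.
rewrite h2// /translate /distribution /pushforward; congr (P _).
by apply/seteqP; split => y /=; rewrite /translation -addrA subrK.
Qed.

(** Adding independent noise of law [P] gives a kernel whose cost does not depend on the input and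
    whose divergences depend only on the difference of the inputs. *)
Lemma KL_star_le_translate (C : R) (K : \bar R) :
  (\int[P]_y (c y)%:E <= C%:E)%E ->
  (forall a, `|a| <= 1 -> (KL P (translate a P) <= K)%E) ->
  (KL_star 1 c C <= K)%E.
Proof.
move=> hC hK; pose k : R.-pker R ~> R := translation_kernel P.
apply: (@le_trans _ _ (ereal_sup [set KL (kernel_at k z.1) (kernel_at k z.2)
    | z in [set z : R * R | `|z.1 - z.2| <= 1]])).
  apply: ereal_inf_lbound; exists k => //.
  by apply: ge_ereal_sup => _ [x _ <-]; rewrite [leLHS]translate_cost.
apply: ge_ereal_sup => _ [[x x'] /= xx' <-].
by rewrite (@KL_translation_mechanism _ _ x x')// hK// distrC.
Qed.

End translation_mechanism.

Lemma cactus_of_grid_mechanism (R : realType) (c : R -> R) (n : nat)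
    (B K eta eps : R) (q : int -> R) :
  cost_function c -> (0 < n)%N -> 0 <= eta <= 2^-1 -> 0 < eps ->
  (forall u v, `|u - v| <= 2 / n%:R -> c v <= (1 + eta) * c u + eta) ->
  grid_mechanism n (cell_cost c n) B K q ->
  exists (N : nat) (P : probability R R), [/\ (0 < N)%N, cactus_class n N 2^-1 P,
    (\int[P]_x (c x)%:E <= (B + eps)%:E)%E &
    forall a, `|a| <= 1 -> (KL P (translate a P) <= (K + eps)%:E)%E].
Proof.
move=> hc n0 /andP[eta0 eta1] eps0 hn hq.
have [q' hq' q'N] := grid_symmetrize (cell_cost_ge0 n hc) (cell_costN c n) hq.
have cbS m : cell_cost c n (Posz m.+1) + 1 <=
    (1 + 2^-1) * (cell_cost c n (Posz m) + 1).
  apply: le_trans (cell_cost_succ n0 m eta0 hn) _.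
  by apply: ler_wpM2r; [rewrite addr_ge0// cell_cost_ge0|lra].
have [N [p [N0 hp]]] := grid_truncation (cell_cost_ge0 n hc) (cell_costN c n)
  cbS hq' q'N eps0.
by have [P [P1 P2 P3]] := cactus_of_grid hc n0 N0 hp; exists N, P.
Qed.

(** [(1 + eta) * C + eta] is [C + eta * (C + 1)], hence the quotient in [eta]; the cap [2^-1]
    provides the growth factor 3/2 that the truncation requires. *)
Lemma cost_growth_fine (R : realType) (c : R -> R) (C eps : R) :
  cost_function c -> 0 <= C -> 0 < eps ->
  exists eta delta : R, [/\ 0 <= eta <= 2^-1, 0 < delta,
    (1 + eta) * C + eta <= C + eps &
    forall u v, `|u - v| <= delta -> c v <= (1 + eta) * c u + eta].
Proof.
move=> hc C0 eps0; pose eta : R := Num.min 2^-1 (eps / (C + 1)).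
have eta0 : 0 < eta by rewrite lt_min invr_gt0 ltr0n/= divr_gt0//; lra.
have [delta delta0 hdelta] := cost_growth hc eta0.
exists eta, delta; split => //.
  by rewrite (ltW eta0) ge_min lexx.
have : eta * (C + 1) <= eps.
  by rewrite -ler_pdivlMr ?ge_min ?lexx ?orbT//; lra.
by lra.
Qed.

Lemma cactus_of_mechanism (R : realType) (c : R -> R) (P : R -> probability R R)
    (C K eps : R) : cost_function c -> 0 < eps ->
  (forall x, (\int[P x]_y (c (y - x))%:E <= C%:E)%E) ->
  (forall x x', `|x - x'| <= 1 -> (KL (P x) (P x') <= K%:E)%E) ->
  exists (n N : nat) (Q : probability R R), [/\ (0 < n)%N, (0 < N)%N,
    cactus_class n N 2^-1 Q, (\int[Q]_x (c x)%:E <= (C + eps)%:E)%E &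
    forall a, `|a| <= 1 -> (KL Q (translate a Q) <= (K + eps)%:E)%E].
Proof.
move=> hc eps0 hC hK; have e2 : 0 < eps / 2 by rewrite divr_gt0.
have C0 : 0 <= C.
  rewrite -lee_fin; apply: le_trans (hC 0); apply: integral_ge0 => y _.
  by rewrite lee_fin cost_ge0.
have [eta [delta [eta01 delta0 heta hdelta]]] := cost_growth_fine hc C0 e2.
have [eta0 _] := andP eta01.
have [n n0 hn] : exists2 n : nat, (0 < n)%N & n%:R^-1 <= delta / 2.
  by apply: exists_inv_le; rewrite divr_gt0.
have hn' u v : `|u - v| <= 2 / n%:R -> c v <= (1 + eta) * c u + eta.
  by move=> uv; apply: hdelta; apply: (le_trans uv); lra.
have [q hq] := grid_of_mechanism hc hC hK n0 eta0 e2 hn'.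
have [N [Q [N0 Q1 Q2 Q3]]] := cactus_of_grid_mechanism hc n0 eta01 e2 hn' hq.
exists n, N, Q; split => //.
  by apply: (le_trans Q2); rewrite lee_fin; lra.
by move=> a a1; apply: (le_trans (Q3 a a1)); rewrite lee_fin; lra.
Qed.

Section KL_cactus.
Variables (R : realType) (C : R) (c : R -> R).
Hypotheses (hC : 0 < C) (hc : cost_function c).

Lemma KL_star_inf_le (n N : nat) (P : probability R R) (C' : R) (K : \bar R) :
  (0 < n)%N -> (0 < N)%N -> cactus_class n N 2^-1 P ->
  (\int[P]_x (c x)%:E <= C'%:E)%E ->
  (forall a, `|a| <= 1 -> (KL P (translate a P) <= K)%E) ->
  (KL_star_inf c C' <= K)%E.
Proof.
move=> n0 N0 hP cP KP.
apply: (@le_trans _ _ (KL_star_nNr c n N 2^-1 C')).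
  apply: ereal_inf_lbound; exists (n, N, 2^-1) => //=; split => //.
  by apply/andP; split; lra.
apply: (@le_trans _ _ (ereal_sup [set KL P (translate a P)
    | a in [set a : R | `|a| <= 1]])).
  by apply: ereal_inf_lbound; exists P => //; split => //=; rewrite unlock.
by apply: ge_ereal_sup => _ [a a1 <-]; exact: KP.
Qed.

Lemma KL_cactus_le : (KL_cactus c C <= KL_star 1 c C)%E.
Proof.
apply: le_ereal_inf_tmp => _ [k hk <-]; set S := ereal_sup _.
have KLS x x' : `|x - x'| <= 1 -> (KL (kernel_at k x) (kernel_at k x') <= S)%E.
  by move=> xx'; apply: ereal_sup_ubound; exists (x, x').
have S0 : (0 <= S)%E.
  by apply: le_trans (KL_ge0 _ _) (KLS 0 0 _); rewrite subrr normr0.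
case: S S0 KLS => [K|_ _|//]; last by rewrite leey.
move=> _ KLS; apply: lime_le; first exact: is_cvg_KL_cactus.
near=> e; have e0 : 0 < e by near: e; exact: nbhs_right_gt.
apply/lee_addgt0Pr => e' e'0.
(* One parameter for both errors: [e] limits the excess cost and the arbitrary [e'] the excess
   divergence. *)
have m0 : 0 < Num.min e e' by rewrite lt_min e0.
have kC x : (\int[kernel_at k x]_y (c (y - x))%:E <= C%:E)%E.
  by apply: le_trans hk; apply: ereal_sup_ubound; exists x.
have [n [N [Q [n0 N0 Q1 Q2 Q3]]]] := cactus_of_mechanism hc m0 kC KLS.
apply: (KL_star_inf_le n0 N0 Q1).
  by apply: (le_trans Q2); rewrite lee_fin lerD2l ge_min lexx.
move=> a a1; apply: (le_trans (Q3 a a1)).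
by rewrite -EFinD lee_fin lerD2l ge_min lexx orbT.
Unshelve. all: by end_near. Qed.

Lemma KL_star_inf_ge0 C' : (0 <= KL_star_inf c C')%E.
Proof.
apply: le_ereal_inf_tmp => _ [t _ <-]; apply: le_ereal_inf_tmp => _ [P _ <-].
apply: le_trans (KL_ge0 P (translate 0 P)) _.
by apply: ereal_sup_ubound; exists 0 => //=; rewrite normr0.
Qed.

(* Mixing a nearly feasible mechanism with a small weight [6 * e / C] of a
   cheap geometric one brings the cost back below [C]. *)
Lemma KL_star_le_perturbed (n0 : nat) (K0 K e eps : R) : (0 < n0)%N -> 0 <= K0 ->
  (forall m, (0 < m)%N ->
    exists g, grid_mechanism (n0 * m) (cell_cost c (n0 * m)) (C / 2) K0 g) ->
  0 < eps -> 0 < e -> 6 * e < C -> 6 * e / C * K0 <= eps ->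
  (KL_star_inf c (C + e) < K%:E)%E ->
  (KL_star 1 c C <= (K + 3 * eps)%:E)%E.
Proof.
move=> n00 K00 hg eps0 e0 eC eK.
move=> /ereal_inf_lt[_ [t _ <-]] /ereal_inf_lt[_ [P [_ /= cP] <-] KP].
have {}cP : (\int[P]_x (c x)%:E <= (C + e)%:E)%E by move: cP; rewrite unlock.
have KPa a : `|a| <= 1 -> (KL P (translate a P) <= K%:E)%E.
  move=> a1; apply: le_trans (ltW KP).
  by apply: ereal_sup_ubound; exists a.
have K1 : 0 <= K.
  rewrite -lee_fin; apply: le_trans (KL_ge0 P (translate 0 P)) (KPa 0 _).
  by rewrite normr0.
have hP1 x : (\int[translate x P]_y (c (y - x))%:E <= (C + e)%:E)%E.
  by rewrite translate_cost.
have hP2 x x' : `|x - x'| <= 1 ->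
    (KL (translate x P) (translate x' P) <= K%:E)%E.
  move=> xx'; rewrite (@KL_translation_mechanism _ P _ _ x x')//.
  by apply: KPa; rewrite distrC.
have Ce0 : 0 <= C + e by lra.
have [eta [delta [eta01 delta0 heta hdelta]]] := cost_growth_fine hc Ce0 e0.
have [eta0 _] := andP eta01.
have [m m0 hm] : exists2 m : nat, (0 < m)%N & m%:R^-1 <= delta / 2.
  by apply: exists_inv_le; rewrite divr_gt0.
(* The mesh is refined along multiples of [n0], where the geometric mechanism is available with the
   same [K0]. *)
have n0' : (0 < n0 * m)%N by rewrite muln_gt0 n00.
have hn u v : `|u - v| <= 2 / (n0 * m)%:R -> c v <= (1 + eta) * c u + eta.
  move=> uv; apply: hdelta; apply: (le_trans uv).
  have : (n0 * m)%:R^-1 <= m%:R^-1 :> R.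
    rewrite lef_pV2 ?posrE ?ltr0n// ler_nat; exact: leq_pmull.
  by lra.
have [q hq] := grid_of_mechanism hc hP1 hP2 n0' eta0 eps0 hn.
have [g hgm] := hg m m0.
(* The cost is at most [C + 2 * e] on the grid and the truncation adds at most [e]; mixing in a cost
   [C / 2] with weight [lam] saves at least [lam * C / 2 = 3 * e]. *)
pose lam : R := 6 * e / C.
have lamC : lam * C = 6 * e by rewrite /lam divfK// gt_eqF.
have lam0 : 0 < lam by rewrite divr_gt0// mulr_gt0.
have lam1 : lam < 1 by rewrite ltr_pdivrMr// mul1r.
have t01 : 0 < 1 - lam < 1 by apply/andP; split; lra.
have hmix := grid_mix (cell_cost_ge0 (n0 * m) hc) t01 hq hgm.
have m0' : 0 < Num.min e eps by rewrite lt_min e0.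
have [N [Q [_ _ Q2 Q3]]] := cactus_of_grid_mechanism hc n0' eta01 m0' hn hmix.
have [le1 le2] : Num.min e eps <= e /\ Num.min e eps <= eps.
  by rewrite !ge_min !lexx orbT.
have le0 : 0 <= lam * e by rewrite mulr_ge0 ?(ltW lam0) ?(ltW e0).
apply: (KL_star_le_translate hc (P := Q)).
  apply: (le_trans Q2); rewrite lee_fin.
  have : (1 - lam) * ((1 + eta) * (C + e) + eta) <= (1 - lam) * (C + e + e).
    by rewrite ler_pM2l//; lra.
  by lra.
move=> a a1; apply: (le_trans (Q3 a a1)); rewrite lee_fin.
have : 0 <= lam * (K + eps) by rewrite mulr_ge0 ?addr_ge0 ?(ltW lam0) ?(ltW eps0).
by rewrite -/lam in eK; lra.
Qed.

Lemma KL_star_le : (KL_star 1 c C <= KL_cactus c C)%E.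
Proof.
have C20 : 0 < C / 2 by rewrite divr_gt0.
have [n0 [K0 [n00 K00 hg]]] := geometric_mechanism hc C20.
have cvL := @is_cvg_KL_cactus R c C.
have L0 : (0 <= KL_cactus c C)%E.
  apply: lime_ge => //; apply: nearW => e; exact: KL_star_inf_ge0.
move: cvL L0; rewrite -/(KL_cactus c C).
case: (KL_cactus c C) => [l cvL _|_ _|//]; last by rewrite leey.
apply/lee_addgt0Pr => eps eps0.
(* One quarter for the distance to the limit, three for the loss [3 * eps] of
   [KL_star_le_perturbed]. *)
have e40 : 0 < eps / 4 by rewrite divr_gt0.
have [fin cvl] : (\forall e \near 0^'+, KL_star_inf c (C + e) \is a fin_num) /\
    (fun e => fine (KL_star_inf c (C + e))) @ 0^'+ --> l.
  by apply/fine_cvgP.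
have [e [e0 eC eK KL]] : exists e, [/\ 0 < e, 6 * e < C,
    6 * e / C * K0 <= eps / 4 & (KL_star_inf c (C + e) < (l + eps / 4)%:E)%E].
  have near1 : \forall e \near 0^'+, `|l - fine (KL_star_inf c (C + e))| < eps / 4.
    by move/cvgrPdist_lt : cvl; apply.
  have z0 : 0 < 6 / C * (K0 + 1) by rewrite mulr_gt0 ?divr_gt0//; lra.
  near (0:R)^'+ => e.
  have e0 : 0 < e by near: e; exact: nbhs_right_gt.
  exists e; split => //.
  - rewrite mulrC -ltr_pdivlMr//; near: e; apply: nbhs_right_lt.
    by rewrite divr_gt0.
  (* [K0] may be 0, hence [K0 + 1] in the bound that determines [e]. *)
  - apply: le_trans (_ : 6 * e / C * (K0 + 1) <= _).
      by rewrite ler_wpM2l ?lerDl// divr_ge0 ?mulr_ge0// ltW.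
    rewrite (_ : _ * _ = e * (6 / C * (K0 + 1))); last by ring.
    rewrite -ler_pdivlMr//; near: e; apply: nbhs_right_le.
    exact: divr_gt0.
  - have ef : KL_star_inf c (C + e) \is a fin_num by near: e; exact: fin.
    rewrite -(fineK ef) lte_fin.
    have : `|l - fine (KL_star_inf c (C + e))| < eps / 4 by near: e; exact: near1.
    by rewrite ltr_distlC => /andP[_].
have := KL_star_le_perturbed n00 K00 hg e40 e0 eC eK KL.
by move=> /le_trans; apply; rewrite -EFinD lee_fin; lra.
Unshelve. all: by end_near. Qed.

End KL_cactus.

Theorem theorem3 (R : realType) (C : R) (c : R -> R) (hC : 0 < C)
  (hc : cost_function c) : KL_star 1 c C = KL_cactus c C.
Proof. by apply/le_anti; rewrite KL_star_le// KL_cactus_le. Qed.
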